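(* Let $f(x)=\frac1N\sum_{i=1}^N f(x,i)$, $x\in\mathbb{R}^n$, where each $f(\cdot,i):\mathbb{R}^n\to\mathbb{R}$ is continuously differentiable and bounded from below and each $\nabla f(\cdot,i)$ is Lipschitz continuous with parameter $L>0$. Let $\{x^t\}_{t\ge1}$ be generated by the random reshuffling method (along an arbitrary sequence of permutations) with step sizes $$\alpha_t=\frac{\alpha}{(t+\beta)^\gamma},\qquad \alpha>0,\quad\beta\ge0,\quad\gamma\in\Big(\frac12,1\Big].$$ Assume that $\{x^t\}_{t\ge1}$ is bounded and that at every accumulation point $\bar x$ of $\{x^t\}_{t\ge1}$ the function $f$ satisfies the KL inequality with a desingularizing function from the class $\mathcal{L}$ of {\L}ojasiewicz functions. Then $\{x^t\}_{t\ge1}$ converges to some stationary point $x^*$ of $f$. Let $\theta\in[0,1)$ and $c>0$ denote the KL exponent of $f$ at $x^*$ and the corresponding KL constant, respectively. Then, for all sufficiently large $t$, if $\gamma\in(\frac12,1)$, $$\|x^t-x^*\|=\begin{cases}\mathcal{O}\big(t^{-(2\gamma-1)}\big) & \text{if } 0\le\theta<\frac{\gamma}{3\gamma-1},\\[2pt] \mathcal{O}\big(t^{-\frac{(1-\theta)(1-\gamma)}{2\theta-1}}\big) & \text{if } \frac{\gamma}{3\gamma-1}\le\theta<1.\end{cases}$$ Moreover, if $\theta\in[0,\frac12]$, $\gamma=1$ and $\alpha>\frac{8c^2}{N}$, then $\|x^t-x^*\|=\mathcal{O}(t^{-1})$.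
   Context: Random reshuffling method: given $x^0\in\mathbb{R}^n$ and step sizes $\alpha_t>0$, at each iteration $t=1,2,\dots$ a permutation $\sigma^t=(\sigma^t_1,\dots,\sigma^t_N)$ of $\{1,\dots,N\}$ is chosen; set $\tilde x^t_0=x^{t-1}$, $\tilde x^t_i=\tilde x^t_{i-1}-\alpha_t\nabla f(\tilde x^t_{i-1},\sigma^t_i)$ for $i=1,\dots,N$, and $x^t=\tilde x^t_N$. (In the algorithm $\sigma^t$ is drawn uniformly at random; the result is about a single trajectory, i.e. an arbitrary fixed sequence of permutations.) Gradients are with respect to $x$. A stationary point of $f$ is a point with $\nabla f=0$. The class of {\L}ojasiewicz functions is $\mathcal{L}=\{\varrho:[0,\infty)\to[0,\infty):\ \exists\,c>0,\ \theta\in[0,1)\text{ with }\varrho(s)=cs^{1-\theta}\}$. KL inequality at $\bar x$ with desingularizing function $\varrho(s)=cs^{1-\theta}\in\mathcal{L}$: there are $\eta\in(0,\infty]$ and a neighborhood $U$ of $\bar x$ such that $\varrho'(|f(x)-f(\bar x)|)\cdot\|\nabla f(x)\|\ge1$, i.e. $|f(x)-f(\bar x)|^\theta\le c(1-\theta)\|\nabla f(x)\|$, for all $x\in U$ with $0<|f(x)-f(\bar x)|<\eta$. In this case $\theta$ is called the KL exponent of $f$ at $\bar x$ and $c$ the corresponding KL constant. *)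

(* Defs.v *)
From HB Require Import structures.
From mathcomp Require Import all_boot all_order all_algebra all_fingroup.
From mathcomp Require Import all_classical all_reals all_analysis.

Set Implicit Arguments.
Unset Strict Implicit.
Unset Printing Implicit Defensive.
Import Order.TTheory GRing.Theory Num.Theory numFieldNormedType.Exports.
Local Open Scope classical_set_scope.
Local Open Scope ring_scope.

(* The library norm `|x| on 'rV[R]_n is the max norm; the Euclidean norm is
   needed because of the explicit constants. Both induce the same topology and
   the same bounded sets, for which the library notions are used. *)
Definition enorm (R : realType) (n : nat) (x : 'rV[R]_n) : R :=
  Num.sqrt (\sum_(j < n) x 0 j ^+ 2).

Definition grad (R : realType) (n : nat) (f : 'rV[R]_n -> R) (x : 'rV[R]_n) :
    'rV[R]_n :=
  \row_(j < n) 'D_(delta_mx 0 j) f x.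

Definition C1 (R : realType) (n : nat) (f : 'rV[R]_n -> R) : Prop :=
  (forall x, differentiable f x) /\ continuous (grad f).

Definition bounded_below (R : realType) (n : nat) (f : 'rV[R]_n -> R) : Prop :=
  exists m : R, forall x, m <= f x.

Definition lipschitz_grad (R : realType) (n : nat) (L : R)
    (f : 'rV[R]_n -> R) : Prop :=
  forall x y, enorm (grad f x - grad f y) <= L * enorm (x - y).

Definition average (R : realType) (n N : nat) (f : 'I_N -> 'rV[R]_n -> R)
    (x : 'rV[R]_n) : R :=
  N%:R^-1 * \sum_(i < N) f i x.

Definition stationary (R : realType) (n : nat) (f : 'rV[R]_n -> R)
    (x : 'rV[R]_n) : Prop :=
  grad f x = 0.

Definition step_size (R : realType) (alpha beta gamma : R) (t : nat) : R :=
  alpha / (t%:R + beta) `^ gamma.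

(* [xt t i] is the i-th inner iterate of iteration t (t >= 1); the component
   indices 1..N are shifted to 0..N-1, so that the inner step from i to i.+1
   uses the component [sigma t i]. The values [step 0], [sigma 0] are unused. *)
Definition rr_trajectory (R : realType) (n N : nat)
    (f : 'I_N -> 'rV[R]_n -> R) (step : nat -> R) (sigma : nat -> {perm 'I_N})
    (x : nat -> 'rV[R]_n) : Prop :=
  exists xt : nat -> nat -> 'rV[R]_n, forall t : nat, (1 <= t)%N ->
    [/\ xt t 0%N = x t.-1,
        forall i : 'I_N,
          xt t i.+1 = xt t i - step t *: grad (f (sigma t i)) (xt t i)
      & x t = xt t N].

Definition lojasiewicz (R : realType) (c theta : R) (s : R) : R :=
  c * s `^ (1 - theta).

(* Functions on [0, +oo[ are represented by functions on R; their values on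
   negative reals are unconstrained and irrelevant. *)
Definition lojasiewicz_class (R : realType) : set (R -> R) :=
  [set rho | exists c theta : R, [/\ 0 < c, 0 <= theta < 1 &
     forall s, 0 <= s -> rho s = lojasiewicz c theta s]].

Definition KL_inequality (R : realType) (n : nat) (f : 'rV[R]_n -> R)
    (rho : R -> R) (xbar : 'rV[R]_n) : Prop :=
  exists (eta : \bar R) (U : set 'rV[R]_n),
    [/\ (0 < eta)%E, nbhs xbar U &
        forall x, U x ->
          0 < `|f x - f xbar| -> (`|f x - f xbar|%:E < eta)%E ->
          1 <= (rho^`())%classic `|f x - f xbar| * enorm (grad f x)].

(* A KL exponent theta with KL constant c; neither is required to be optimal. *)
Definition KL_exponent (R : realType) (n : nat) (f : 'rV[R]_n -> R)
    (xbar : 'rV[R]_n) (c theta : R) : Prop :=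
  [/\ 0 < c, 0 <= theta < 1 & KL_inequality f (lojasiewicz c theta) xbar].

(* Main.v *)
Require Import Defs.
From HB Require Import structures.
From mathcomp Require Import all_boot all_order all_algebra all_fingroup.
From mathcomp Require Import all_classical all_reals all_analysis.
From mathcomp Require Import ring lra.

Set Implicit Arguments.
Unset Strict Implicit.
Unset Printing Implicit Defensive.
Import Order.TTheory GRing.Theory Num.Theory numFieldNormedType.Exports.
Local Open Scope classical_set_scope.
Local Open Scope ring_scope.

(* One epoch is a gradient step x+ = x - h (grad F x + e) with h = N alpha_t and
   |e| <= E h, so the descent lemma gives
     F(x+) <= F(x) - h/2 |grad F x|^2 + O(h^3).
   As h = O(t^-gamma), adding the explicit corrector u_t = U t^-(3 gamma - 1)
   to F(x^t) - lim F yields a nonincreasing energy Phi_t -> 0. A KL inequality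
   with exponent theta persists with any larger exponent; one with
   theta >= gamma / (3 gamma - 1) gives, by concavity of s^(1 - theta),
     |x+ - x| <= V_t - V_{t+1},
     V_t = K Phi_t^(1 - theta) + W t^-(2 gamma - 1).
   Hence the sequence is trapped near a cluster point p and |x^t - p| <= V_t.
   The rate then follows from Phi_t = O(t^-s), where gamma + 2 theta s = s + 1:
   by the KL inequality, once Phi_t dominates M t^-s with M large, it decreases
   faster than M t^-s does. *)

(** * Euclidean inner product and norm; comparison with the max norm *)

Section Euclidean.
Context {R : realType} {n : nat}.
Implicit Types (u v w : 'rV[R]_n) (a : R).

Definition dot u v : R := \sum_(j < n) u 0 j * v 0 j.

Lemma dotC u v : dot u v = dot v u.
Proof. by apply: eq_bigr => j _; rewrite mulrC. Qed.

Lemma dotDl u v w : dot (u + v) w = dot u w + dot v w.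
Proof. by rewrite -big_split; apply: eq_bigr => j _; rewrite !mxE mulrDl. Qed.

Lemma dotZl a u v : dot (a *: u) v = a * dot u v.
Proof. by rewrite big_distrr; apply: eq_bigr => j _; rewrite !mxE -mulrA. Qed.

Lemma dotDr u v w : dot w (u + v) = dot w u + dot w v.
Proof. by rewrite !(dotC w) dotDl. Qed.

Lemma dotZr a u v : dot u (a *: v) = a * dot u v.
Proof. by rewrite !(dotC u) dotZl. Qed.

Lemma dot_ge0 u : 0 <= dot u u.
Proof. by apply: sumr_ge0 => j _; rewrite -expr2 sqr_ge0. Qed.

Lemma enorm_ge0 u : 0 <= enorm u.
Proof. exact: sqrtr_ge0. Qed.

Lemma sqr_enorm u : enorm u ^+ 2 = dot u u.
Proof.
by rewrite sqr_sqrtr; [|apply: sumr_ge0 => j _; rewrite sqr_ge0].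
Qed.

Lemma enorm_eq0 u : enorm u = 0 -> u = 0.
Proof.
move=> u0; have : dot u u = 0 by rewrite -sqr_enorm u0 expr0n.
move/eqP; rewrite psumr_eq0 => [/allP uj0|j _]; last by rewrite -expr2 sqr_ge0.
apply/rowP => j; rewrite mxE; apply/eqP.
by have := uj0 j (mem_index_enum _); rewrite mulf_eq0 orbb.
Qed.

Lemma enorm0 : enorm (0 : 'rV[R]_n) = 0.
Proof. by rewrite /enorm big1 ?sqrtr0// => j _; rewrite mxE expr0n. Qed.

Lemma dot0l u : dot 0 u = 0.
Proof. by rewrite -(scale0r u) dotZl mul0r. Qed.

Lemma dot_le_enorm u v : dot u v <= enorm u * enorm v.
Proof.
have [u0|un0] := eqVneq (enorm u) 0.
  by rewrite u0 (enorm_eq0 u0) dot0l mul0r.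
have [v0|vn0] := eqVneq (enorm v) 0.
  by rewrite v0 (enorm_eq0 v0) dotC dot0l mulr0.
have uv0 : 0 < enorm u * enorm v.
  by rewrite mulr_gt0// lt0r ?un0 ?vn0 enorm_ge0.
(* The square expands to twice [enorm u * enorm v] times the gap in the claim, so the positive
   product [uv0] can be cancelled. *)
have := dot_ge0 (enorm v *: u + (- enorm u) *: v).
rewrite !(dotDl, dotDr, dotZl, dotZr) -!sqr_enorm (dotC v u) => h.
rewrite -(ler_pM2l uv0); lra.
Qed.

Lemma enormN u : enorm (- u) = enorm u.
Proof. by congr Num.sqrt; apply: eq_bigr => j _; rewrite mxE sqrrN. Qed.

Lemma enormB u v : enorm (u - v) = enorm (v - u).
Proof. by rewrite -opprB enormN. Qed.

Lemma enormZ a u : enorm (a *: u) = `|a| * enorm u.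
Proof.
apply/eqP; rewrite -(@eqrXn2 _ 2) ?mulr_ge0 ?enorm_ge0//.
by rewrite exprMn !sqr_enorm dotZl dotZr mulrA real_normK ?num_real// expr2.
Qed.

Lemma enormD u v : enorm (u + v) <= enorm u + enorm v.
Proof.
rewrite -(@ler_pXn2r _ 2) ?nnegrE ?addr_ge0 ?enorm_ge0//.
rewrite sqr_enorm !(dotDl, dotDr) -!sqr_enorm (dotC v u).
have := dot_le_enorm u v; lra.
Qed.

Lemma enorm_sum (I : Type) (r : seq I) (P : pred I) (v : I -> 'rV[R]_n) :
  enorm (\sum_(i <- r | P i) v i) <= \sum_(i <- r | P i) enorm (v i).
Proof.
elim/big_rec2: _ => [|i y1 y2 _ IH]; first by rewrite enorm0.
by rewrite (le_trans (enormD _ _))// lerD2l.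
Qed.

Lemma norm_le_enorm u : `|u| <= enorm u.
Proof.
rewrite (_ : `|u| = mx_norm u)// mx_normrE; apply: bigmax_le => [|[i j] _ /=].
  exact: enorm_ge0.
rewrite -(@ler_pXn2r _ 2) ?nnegrE ?enorm_ge0// sqr_enorm ord1.
rewrite real_normK ?num_real// /dot (bigD1 j)//= -expr2 lerDl.
by apply: sumr_ge0 => k _; rewrite -expr2 sqr_ge0.
Qed.

(** The cruder factor [1 + n] avoids the root of [n] and stays positive for [n = 0], so that
    [enorm_nbhs] can divide by it. *)
Lemma enorm_le_norm u : enorm u <= (1 + n%:R) * `|u|.
Proof.
rewrite -(@ler_pXn2r _ 2) ?nnegrE ?enorm_ge0 ?mulr_ge0 ?addr_ge0//.
rewrite sqr_enorm exprMn.
have uj j : u 0 j ^+ 2 <= `|u| ^+ 2.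
  rewrite -[u 0 j ^+ 2]real_normK ?num_real// ler_pXn2r ?nnegrE//.
  rewrite (_ : `|u| = mx_norm u)// mx_normrE.
  exact: (le_bigmax_cond 0 (fun ij => `|u ij.1 ij.2|) (erefl true : xpredT (0, j))).
have : dot u u <= n%:R * `|u| ^+ 2.
  rewrite -[n in n%:R]card_ord mulr_natl -sumr_const.
  by apply: ler_sum => j _; rewrite -expr2.
move/le_trans; apply; apply: ler_wpM2r; first exact: sqr_ge0.
have : 0 <= (n%:R : R) by []. nra.
Qed.

Lemma nbhs_enorm u (U : set 'rV[R]_n) : nbhs u U ->
  exists2 r, 0 < r & forall v, enorm (v - u) < r -> U v.
Proof.
move=> /nbhs_ballP[r /= r0 rU]; exists r => // v vr; apply: rU.
by rewrite -ball_normE /=; apply: le_lt_trans (norm_le_enorm _) _; rewrite enormB.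
Qed.

Lemma enorm_nbhs u r : 0 < r -> nbhs u [set v | enorm (v - u) < r].
Proof.
move=> r0; apply/nbhs_ballP; exists (r / (1 + n%:R)) => [|v] /=.
  by rewrite divr_gt0// ltr_wpDr.
rewrite -ball_normE /= ltr_pdivlMr ?ltr_wpDr// mulrC enormB.
exact: le_lt_trans (enorm_le_norm _).
Qed.

End Euclidean.

(** * Gradients, the mean value theorem along segments, and averages *)

Section Gradient.
Context {R : realType} {n : nat}.
Implicit Types (f : 'rV[R]_n -> R) (x y v : 'rV[R]_n).

Lemma derive_grad f x v : differentiable f x -> 'D_v f x = dot (grad f x) v.
Proof.
move=> df; rewrite deriveE// [in LHS](row_sum_delta v) linear_sum.
by apply: eq_bigr => j _; rewrite linearZ /= !mxE deriveE// mulrC.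
Qed.

Lemma mean_value f x y : (forall z, differentiable f z) ->
  exists2 s, 0 <= s <= 1 &
    f y - f x = dot (grad f (x + s *: (y - x))) (y - x).
Proof.
move=> df; pose l (s : R) := x + s *: (y - x).
have dl (s : R) : is_derive s 1 (f \o l) (dot (grad f (l s)) (y - x)).
  (* The difference quotient of [f \o l] at [s] is literally that of [f] at [l s] in direction
     [y - x], so no chain rule is needed. *)
  have quotientE : (fun h : R => h^-1 *: ((f \o l \o shift s) (h *: 1) - (f \o l) s)) =
      (fun h => h^-1 *: ((f \o shift (l s)) (h *: (y - x)) - f (l s))).
    apply/funext => h /=; congr (_ *: (f _ - _)).
    by rewrite /l scalerDl -scalerA scale1r addrCA.
  apply: DeriveDef; first by rewrite /derivable quotientE; exact: diff_derivable.
  by rewrite -derive_grad// /derive quotientE.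
have [|s] := @MVT_segment R (f \o l) _ 0 1 ler01 (fun s _ => dl s).
  apply: continuous_subspaceT => s; apply: differentiable_continuous.
  by apply/derivable1_diffP; case: (dl s).
rewrite in_itv /= => s01; rewrite subr0 mulr1 => fs; exists s => //.
by rewrite -[in RHS]fs /l /= scale1r scale0r addr0 [x + _]addrC subrK.
Qed.

(** The mean value theorem at a single point, without integration, gives [L] in place of the usual
    [L / 2]; the smallness of the steps absorbs the loss. *)
Lemma grad_lipschitz_le f L x y : 0 <= L -> (forall z, differentiable f z) ->
  lipschitz_grad L f ->
  f y <= f x + dot (grad f x) (y - x) + L * enorm (y - x) ^+ 2.
Proof.
move=> L0 df fL; have [s /andP[s0 s1] fxy] := mean_value x y df.
rewrite -lerBlDl opprD addrA fxy -[X in dot X _](subrK (grad f x)).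
rewrite dotDl addrK (le_trans (dot_le_enorm _ _))// expr2 mulrA.
rewrite ler_wpM2r ?enorm_ge0// (le_trans (fL _ _))// ler_wpM2l//.
by rewrite addrAC subrr add0r enormZ ger0_norm// ler_piMl ?enorm_ge0.
Qed.

Context {N : nat}.
Variable F : 'I_N -> 'rV[R]_n -> R.
Hypothesis dF : forall i x, differentiable (F i) x.

Lemma averageE : average F = N%:R^-1 \*: \sum_(i < N) F i.
Proof. by apply/funext => x; rewrite /average /= fct_sumE. Qed.

Lemma differentiable_average x : differentiable (average F) x.
Proof. by rewrite averageE; apply/differentiableZ/differentiable_sum. Qed.

Lemma grad_average x :
  grad (average F) x = N%:R^-1 *: \sum_(i < N) grad (F i) x.
Proof.
have dFi i v : derivable (F i) x v by exact: diff_derivable.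
apply/rowP => j; rewrite !mxE summxE averageE deriveZ; last exact: derivable_sum.
by rewrite derive_sum//; congr (_ * _); apply: eq_bigr => i _; rewrite mxE.
Qed.

Lemma lipschitz_grad_average L : (0 < N)%N ->
  (forall i, lipschitz_grad L (F i)) -> lipschitz_grad L (average F).
Proof.
move=> N0 FL x y; rewrite !grad_average -scalerBr -sumrB enormZ.
rewrite ger0_norm ?invr_ge0// ler_pdivrMl ?ltr0n//.
apply: le_trans (enorm_sum _ _ _) _.
rewrite mulr_natl -[N in X in _ <= X]card_ord -sumr_const.
by apply: ler_sum => i _; exact: FL.
Qed.

End Gradient.

(** With [g] the gradient at [x], Young's inequality charges [h / 4] of [|g|^2] and [h] of [|e|^2]
    for the cross term. As [L h^2 <= h / 8], the quadratic term costs a further [h / 4] of each,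
    which leaves [- h / 2] and [5 / 4 * h]. *)
Lemma perturbed_descent {R : realType} {n : nat} (F : 'rV[R]_n -> R) (L h : R)
    (x e : 'rV[R]_n) :
  0 <= L -> (forall z, differentiable F z) -> lipschitz_grad L F ->
  0 <= h -> 8 * L * h <= 1 ->
  F (x - h *: (grad F x + e)) <=
    F x - h / 2 * enorm (grad F x) ^+ 2 + 5 / 4 * h * enorm e ^+ 2.
Proof.
move=> L0 dF FL h0 Lh.
apply: le_trans (grad_lipschitz_le x _ L0 dF FL) _.
set g := grad F x; rewrite [x - _ - x]addrAC subrr add0r enormN enormZ ger0_norm//.
rewrite -scaleNr dotZr exprMn dotDr -sqr_enorm.
have young : 0 <= enorm g ^+ 2 / 4 + dot g e + enorm e ^+ 2.
  have := dot_ge0 ((1/2) *: g + e).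
  rewrite !(dotDl, dotDr, dotZl, dotZr) -!sqr_enorm (dotC e g); lra.
have ge2 : enorm (g + e) ^+ 2 <= 2 * enorm g ^+ 2 + 2 * enorm e ^+ 2.
  have := dot_ge0 (g + (-1) *: e).
  rewrite sqr_enorm !(dotDl, dotDr, dotZl, dotZr) -!sqr_enorm (dotC e g); lra.
have Lh2 : L * h ^+ 2 <= h / 8 by nra.
have Lh20 : 0 <= L * h ^+ 2 by rewrite mulr_ge0 ?sqr_ge0.
have := ler_wpM2l h0 young; have := ler_wpM2l Lh20 ge2.
have := ler_wpM2r (sqr_ge0 (enorm g)) Lh2.
have := ler_wpM2r (sqr_ge0 (enorm e)) Lh2.
lra.
Qed.

(** * One epoch as a perturbed gradient step of the average *)

Section Epoch.
Context {R : realType} {n N : nat}.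
Variables (f : 'I_N -> 'rV[R]_n -> R) (L G a : R) (s : {perm 'I_N}).
Variable (y : nat -> 'rV[R]_n).
Hypothesis L0 : 0 <= L.
Hypothesis fL : forall i, lipschitz_grad L (f i).
Hypothesis a0 : 0 <= a.
Hypothesis aLN : 2 * L * (N%:R * a) <= 1.
Hypothesis yS : forall i : 'I_N, y i.+1 = y i - a *: grad (f (s i)) (y i).
Hypothesis gradG : forall i, enorm (grad (f i) (y 0%N)) <= G.

(** Induction: as long as the drift obeys the bound, [aLN] makes [L] times the drift at most [G], so
    the next component gradient has norm at most [2 * G]. *)
Lemma epoch_drift i : (i <= N)%N -> enorm (y i - y 0%N) <= 2 * a * G * i%:R.
Proof.
elim: i => [_|i IH iN]; first by rewrite subrr enorm0 mulr0.
have {IH} := IH (ltnW iN); have := yS (Ordinal iN) => /= ->.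
set g := grad _ _; set r := y i - y 0%N => ri.
rewrite addrAC -/r; apply: le_trans (enormD _ _) _.
rewrite enormN enormZ ger0_norm//.
have gr : enorm g <= G + L * enorm r.
  rewrite /g -[grad _ _](subrK (grad (f (s (Ordinal iN))) (y 0%N))) addrC.
  by rewrite (le_trans (enormD _ _))// lerD// fL.
have G0 : 0 <= G := le_trans (enorm_ge0 _) (gradG (Ordinal iN)).
have iN' : i%:R <= N%:R :> R by rewrite ler_nat ltnW.
have Lr : L * enorm r <= G.
  apply: le_trans (ler_wpM2l L0 ri) _.
  have : 2 * L * (N%:R * a) * G <= G by rewrite ler_piMl.
  apply: le_trans; rewrite (_ : L * _ = 2 * L * (i%:R * a) * G); last by ring.
  by rewrite ler_wpM2r// ler_wpM2l ?mulr_ge0// ler_wpM2r.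
rewrite -natr1.
have : a * enorm g <= a * (G + G) by rewrite ler_wpM2l// (le_trans gr)// lerD2l.
lra.
Qed.

(** The error [e] averages the changes of the component gradients between the start of the epoch and
    their use; each is controlled by [epoch_drift]. *)
Lemma epoch_gradient_step : (0 < N)%N -> (forall i x, differentiable (f i) x) ->
  exists2 e, enorm e <= 2 * L * G * (N%:R * a) &
    y N = y 0%N - (N%:R * a) *: (grad (average f) (y 0%N) + e).
Proof.
move=> N0 df; have N_neq0 : N%:R != 0 :> R by rewrite pnatr_eq0 -lt0n.
exists (N%:R^-1 *: \sum_(i < N) (grad (f (s i)) (y i) - grad (f (s i)) (y 0%N))).
  rewrite enormZ ger0_norm ?invr_ge0// ler_pdivrMl ?ltr0n//.
  apply: le_trans (enorm_sum _ _ _) _.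
  rewrite -[leRHS](_ : \sum_(i < N) 2 * L * G * (N%:R * a) = _); last first.
    by rewrite sumr_const card_ord [RHS]mulr_natl.
  apply: ler_sum => i _; apply: le_trans (fL _ _ _) _.
  apply: le_trans (ler_wpM2l L0 (epoch_drift (ltnW (ltn_ord i)))) _.
  have G0 : 0 <= G := le_trans (enorm_ge0 _) (gradG i).
  rewrite (_ : L * _ = 2 * L * G * (i%:R * a)); last by ring.
  by rewrite ler_wpM2l ?mulr_ge0// ler_wpM2r// ler_nat ltnW.
(* Gradients at the common point [y 0] may be summed in the order of [s]; this is where the choice
   of permutation drops out. *)
rewrite grad_average// [in X in _ *: (X + _)](reindex_inj (@perm_inj _ s)) /=.
rewrite -scalerDr -big_split /= scalerA mulrAC mulfV// mul1r.
under eq_bigr do rewrite addrC subrK.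
have ysum k : (k <= N)%N ->
    y k = y 0%N - a *: \sum_(i < N | (i < k)%N) grad (f (s i)) (y i).
  elim: k => [_|k IH kN]; first by rewrite big_pred0 ?scaler0 ?subr0.
  rewrite (bigD1 (Ordinal kN))//= scalerDr opprD addrCA addrC.
  rewrite (eq_bigl (fun i : 'I_N => (i < k)%N)); last first.
    by move=> i; rewrite ltnS -val_eqE /= ltn_neqAle andbC.
  rewrite -(IH (ltnW kN)); exact: (yS (Ordinal kN)).
rewrite (ysum _ (leqnn N)); congr (_ - _ *: _).
by apply: eq_bigl => i; rewrite ltn_ord.
Qed.

End Epoch.

(** * Tangent inequalities and discrete derivatives of real powers *)

Section RealPowers.
Context {R : realType}.
Implicit Types (x y r p q A B theta : R) (t : nat).

Lemma powR_le_tangent1 y r : 0 <= y -> 0 <= r <= 1 -> y `^ r <= 1 + r * (y - 1).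
Proof.
move=> y0 /andP[r0 r1]; have [->|yn0] := eqVneq y 0.
  have [->|rn0] := eqVneq r 0; first by rewrite powRr0 mul0r addr0.
  rewrite powR0//; lra.
have {yn0}y_gt0 : 0 < y by rewrite lt0r yn0.
have [->|r1'] := eqVneq r 1; first by rewrite powRr1// mul1r addrC subrK.
have {r1' r1}r_lt1 : r < 1 by rewrite lt_neqAle r1'.
(* [z] is the mean of [y] and [1] with weights [r] and [1 - r]. Averaging the tangent bounds of [ln]
   at [z] with these weights cancels the right-hand sides. *)
set z := 1 + _; have z0 : 0 < z by rewrite /z; nra.
rewrite /powR (gt_eqF y_gt0) -[leRHS](lnK z0) ler_expR.
have lnB v : 0 < v -> ln v - ln z <= v / z - 1.
  move=> v0; rewrite -ln_div// -[X in ln X](subrK 1) addrC.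
  by rewrite le_ln1Dx// ltrBrDl subrr divr_gt0.
have := ler_wpM2l r0 (lnB y y_gt0).
have := ler_wpM2l (ltW (_ : 0 < 1 - r)) (lnB 1 ltr01); rewrite ln1 subr_gt0.
move=> /(_ r_lt1) h1 h2.
have : r * (y / z - 1) + (1 - r) * (1 / z - 1) = 0.
  by rewrite /z; field; rewrite gt_eqF.
lra.
Qed.

(** Concavity of the power at [A], obtained by homogeneity from [powR_le_tangent1] at [B / A];
    [B = 0] is allowed. *)
Lemma powR_le_tangent A B r : 0 < A -> 0 <= B -> 0 <= r <= 1 ->
  r * A `^ (r - 1) * (A - B) <= A `^ r - B `^ r.
Proof.
move=> A0 B0 r01; have BA0 : 0 <= B / A by rewrite divr_ge0// ltW.
have := ler_wpM2l (powR_ge0 A r) (powR_le_tangent1 BA0 r01).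
rewrite -powRM ?(ltW A0)// mulrCA mulfV ?gt_eqF// mulr1.
have -> : A `^ (r - 1) = A `^ r / A.
  by rewrite powRB ?powRr1 ?(ltW A0)// (gt_eqF A0) implybT.
have -> : r * (A `^ r / A) * (A - B) = A `^ r * (r * (1 - B / A)).
  by field; rewrite gt_eqF.
lra.
Qed.

Lemma powRN_ge_tangent1 x r : 0 < x -> 0 <= r -> 1 - r * (x - 1) <= x `^ (- r).
Proof.
move=> x0 r0; rewrite /powR gt_eqF//; apply: le_trans (expR_ge1Dx _).
rewrite lerD2l mulNr lerN2 ler_wpM2l//.
by rewrite -[X in ln X](subrK 1) addrC le_ln1Dx// ltrBrDl subrr.
Qed.

(** Convexity of the negative power, with the tangent taken at [t.+1]. It lets errors of order
    [t^-(r + 1)] be paid by the decrease of a corrector; [powRN_decr_le] takes the tangent at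
    [t]. *)
Lemma powRN_decr_ge t r : (0 < t)%N -> 0 <= r ->
  r * t.+1%:R `^ (- (r + 1)) <= t%:R `^ (- r) - t.+1%:R `^ (- r).
Proof.
move=> t0 r0; have t_gt0 : 0 < t%:R :> R by rewrite ltr0n.
have tS0 : 0 < t.+1%:R :> R by rewrite ltr0n.
have := powRN_ge_tangent1 (divr_gt0 t_gt0 tS0) r0.
move=> /(ler_wpM2l (powR_ge0 t.+1%:R (- r))).
rewrite -powRM ?divr_ge0 ?ler0n// mulrCA mulfV ?gt_eqF// mulr1.
have -> : (t.+1%:R : R) `^ (- (r + 1)) = t.+1%:R `^ (- r) / t.+1%:R.
  by rewrite opprD powRB ?powRr1// (gt_eqF tS0) implybT.
have -> : t%:R / t.+1%:R - 1 = - t.+1%:R^-1 :> R.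
  by rewrite -natr1; field; rewrite natr1 gt_eqF.
set i := t.+1%:R^-1; set X := t.+1%:R `^ _; lra.
Qed.

Lemma powRN_decr_le t r : (0 < t)%N -> 0 <= r ->
  t%:R `^ (- r) - t.+1%:R `^ (- r) <= r * t%:R `^ (- (r + 1)).
Proof.
move=> t0 r0; have t_gt0 : 0 < t%:R :> R by rewrite ltr0n.
have tS0 : 0 < t.+1%:R :> R by rewrite ltr0n.
have := powRN_ge_tangent1 (divr_gt0 tS0 t_gt0) r0.
move=> /(ler_wpM2l (powR_ge0 t%:R (- r))).
rewrite -powRM ?divr_ge0 ?ler0n// mulrCA mulfV ?gt_eqF// mulr1.
have -> : (t%:R : R) `^ (- (r + 1)) = t%:R `^ (- r) / t%:R.
  by rewrite opprD powRB ?powRr1// (gt_eqF t_gt0) implybT.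
have -> : t.+1%:R / t%:R - 1 = t%:R^-1 :> R.
  by rewrite -natr1; field; rewrite gt_eqF.
set Y := t.+1%:R `^ _; lra.
Qed.

Lemma powRN_le_succ t r : (0 < t)%N -> 0 <= r ->
  t%:R `^ (- r) <= 2 `^ r * t.+1%:R `^ (- r) :> R.
Proof.
move=> t0 r0; rewrite !powRN.
rewrite ler_pdivlMr ?powR_gt0 ?ltr0n// mulrC ler_pdivrMr ?powR_gt0 ?ltr0n//.
rewrite -powRM// ge0_ler_powR ?nnegrE ?mulr_ge0//.
by rewrite -natrM ler_nat mul2n -addnn -[t.+1]addn1 leq_add2l.
Qed.

Lemma powRN_le t r p : (0 < t)%N -> p <= r -> t%:R `^ (- r) <= t%:R `^ (- p) :> R.
Proof. by move=> t0 pr; rewrite ler_powR ?ler1n// lerN2. Qed.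

(** Passing from [t] to [t.+1] loses a relative amount of at most [(p + 1) / t], which the gap
    between [p] and [q] eventually covers. *)
Lemma powRN_succ_ratio p q : 0 <= p < q -> exists T : nat, forall t, (T <= t)%N ->
  (0 < t)%N -> p * t%:R `^ (- (p + 1)) <= q * t.+1%:R `^ (- (p + 1)).
Proof.
move=> /andP[p0 pq]; have qp0 : 0 < q - p by rewrite subr_gt0.
have /archi_boundP/ltW hT : 0 <= q * (p + 1) / (q - p).
  by apply: divr_ge0 (ltW qp0); apply: mulr_ge0; lra.
exists (Num.bound (q * (p + 1) / (q - p))) => t Tt t0; have t_gt0 : 0 < t%:R :> R by rewrite ltr0n.
have p1 : 0 <= p + 1 by rewrite addr_ge0.
have := powRN_decr_le t0 p1.
have -> : (t%:R : R) `^ (- (p + 1 + 1)) = t%:R `^ (- (p + 1)) / t%:R.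
  by rewrite opprD powRB ?powRr1// (gt_eqF t_gt0) implybT.
set X := t%:R `^ _; set Y := t.+1%:R `^ _ => XY.
have X0 : 0 <= X := powR_ge0 _ _.
have hq : q * (p + 1) / t%:R <= q - p.
  rewrite ler_pdivrMr// [leRHS]mulrC -ler_pdivrMr//; apply: le_trans hT _.
  by rewrite ler_nat.
have q0 : 0 <= q by lra.
have := ler_wpM2l q0 XY; have := ler_wpM2l X0 hq.
have -> : q * ((p + 1) * (X / t%:R)) = X * (q * (p + 1) / t%:R) by ring.
lra.
Qed.

Lemma half_powR_le A theta : 0 <= A -> 0 <= theta <= 1 ->
  A `^ theta / 2 <= (A / 2) `^ theta.
Proof.
move=> A0 /andP[th0 th1]; rewrite powRM// ler_wpM2l ?powR_ge0//.
by rewrite -[leLHS]powRr1// ger_powR//; lra.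
Qed.

Lemma powR_cvg0_near theta e : 0 < theta -> 0 < e ->
  exists2 d, 0 < d & forall s, 0 <= s -> s < d -> s `^ theta < e.
Proof.
move=> th0 e0; exists (e `^ theta^-1); first exact: powR_gt0.
move=> s s0 /(gt0_ltr_powR th0); rewrite !nnegrE powR_ge0 => /(_ s0 isT).
by rewrite -powRrM mulVf ?gt_eqF// powRr1// ltW.
Qed.

End RealPowers.

(** * Scalar recursions driven by the KL inequality *)

Section KLRecursion.
Context {R : realType}.
Implicit Types (theta s u v : R) (t : nat).

(** In the application [phi] is the energy, [u] its corrector, [s] the gap [|F x - F p|] and [v] a
    multiple of the gradient norm. A corrector of at most half the energy leaves [s >= phi / 2]. *)
Lemma kl_dominant theta phi u s v : 0 <= theta <= 1 -> 0 <= phi ->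
  phi - u <= s -> s `^ theta <= v -> u <= phi / 2 -> phi `^ theta / 2 <= v.
Proof.
move=> th01 phi0 us sv uphi; apply: le_trans sv.
apply: le_trans (half_powR_le phi0 th01) _; have /andP[th0 _] := th01.
by rewrite ge0_ler_powR ?nnegrE//; lra.
Qed.

Lemma kl_dichotomy theta phi u s v : 0 <= theta <= 1 -> 0 <= phi -> 0 <= u ->
  phi - u <= s -> s `^ theta <= v -> phi `^ theta / 2 <= v \/ v <= u `^ theta.
Proof.
move=> th01 phi0 u0 us sv; have [up|pu] := leP u (phi / 2).
  by left; exact: kl_dominant us sv up.
have [|vp] := leP (phi `^ theta / 2) v; [by left|right; apply: le_trans (ltW vp) _].
have /andP[th0 _] := th01; apply: le_trans (half_powR_le phi0 th01) _.
by rewrite ge0_ler_powR ?nnegrE ?divr_ge0// ltW.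
Qed.

(* Either the energy drop pays for the step through concavity of
   [phi `^ (1 - theta)], or the gradient is dominated by the noise [u]. *)
Lemma kl_step theta C h a phi phi' u s : 0 < theta < 1 -> 0 < C -> 0 <= h ->
  0 <= a -> 0 <= phi' -> 0 <= u -> phi' <= phi - h / 2 * a ^+ 2 ->
  phi - u <= s -> s `^ theta <= C * a ->
  h * a <= 4 * C / (1 - theta) * (phi `^ (1 - theta) - phi' `^ (1 - theta))
           + h * u `^ theta / C.
Proof.
move=> /andP[th0 th1] C0 h0 a0 phi'0 u0 desc us sCa.
have ha0 : 0 <= h / 2 * a ^+ 2 by rewrite !mulr_ge0 ?invr_ge0 ?sqr_ge0.
have phi0 : 0 <= phi by lra.
have phi'phi : phi' <= phi by lra.
have th01 : 0 <= theta <= 1 by rewrite !ltW.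
have eta0 : 0 < 1 - theta by lra.
have noise0 : 0 <= h * u `^ theta / C by rewrite !mulr_ge0 ?powR_ge0 ?invr_ge0 ?(ltW C0).
have drop0 : 0 <= 4 * C / (1 - theta) * (phi `^ (1 - theta) - phi' `^ (1 - theta)).
  rewrite mulr_ge0 ?subr_ge0 ?ge0_ler_powR ?nnegrE ?(ltW eta0)//.
  by rewrite divr_ge0 ?(ltW eta0)// mulr_ge0// ltW.
have [aphi|aphi] := kl_dichotomy th01 phi0 u0 us sCa; last first.
  apply: (ler_wpDl drop0).
  by rewrite -mulrA ler_wpM2l// ler_pdivlMr// mulrC.
apply: (ler_wpDr noise0); rewrite mulrAC ler_pdivlMr//.
(* The tangent inequality needs [phi > 0]. At [phi = 0] the drop forces [h = 0] or [a = 0], so there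
   is no step to pay for. *)
have [phi_eq0|phin0] := eqVneq phi 0.
  have /eqP : h / 2 * a ^+ 2 = 0 by lra.
  rewrite mulf_eq0 sqrf_eq0 mulf_eq0 invr_eq0 pnatr_eq0 orbF => /orP[] /eqP ->;
    rewrite ?mul0r ?mulr0 ?mul0r !mulr_ge0 ?(ltW C0)// subr_ge0;
    by rewrite ge0_ler_powR ?nnegrE// ltW.
have phi_gt0 : 0 < phi by rewrite lt0r phin0.
have eta01 : 0 <= 1 - theta <= 1 by lra.
have := powR_le_tangent phi_gt0 phi'0 eta01.
rewrite addrAC subrr add0r powRN => tangent.
have P0 : 0 < phi `^ theta by exact: powR_gt0.
(* One factor 2 of the [4] comes from [phi^theta / 2 <= C * a], the other from the [h / 2] in the
   drop. *)
have hP : h * a <= 4 * C * ((phi `^ theta)^-1 * (phi - phi')).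
  have -> : h * a = 4 * C * ((phi `^ theta)^-1 *
      (h * a * phi `^ theta / (4 * C))) by field; rewrite !gt_eqF.
  rewrite ler_wpM2l ?mulr_ge0 ?(ltW C0)// ler_wpM2l ?invr_ge0 ?(ltW P0)//.
  rewrite ler_pdivrMr ?mulr_gt0//.
  have := ler_wpM2l (mulr_ge0 h0 a0) aphi.
  have := ler_wpM2r (ltW C0) desc; lra.
apply: le_trans (ler_wpM2r (ltW eta0) hP) _.
rewrite -!mulrA ler_wpM2l// ler_wpM2l ?(ltW C0)//.
by move: tangent; set P := _^-1; lra.
Qed.

(** The condition [gamma <= theta * (3 * gamma - 1)] makes the corrector to the power [theta] of
    order [t^-gamma]. Both terms are then of order [t^-(2 gamma)], the order of the decrement of
    [t^-(2 gamma - 1)]. *)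
Lemma noise_telescopes gamma theta C U H E h t : 1 / 2 < gamma <= 1 ->
  0 <= theta -> gamma <= theta * (3 * gamma - 1) -> 0 < C -> 0 <= U -> 0 <= E ->
  (0 < t)%N -> 0 <= h -> h <= H * t.+1%:R `^ (- gamma) ->
  h * (U * t%:R `^ (- (3 * gamma - 1))) `^ theta / C + E * h ^+ 2 <=
  (2 * H * U `^ theta / C + E * H ^+ 2) / (2 * gamma - 1) *
    (t%:R `^ (- (2 * gamma - 1)) - t.+1%:R `^ (- (2 * gamma - 1))).
Proof.
move=> /andP[g12 g1] th0 gth C0 U0 E0 t0 h0 hH.
have rho0 : 0 < 2 * gamma - 1 by lra.
have := powRN_decr_ge t0 (ltW rho0); rewrite subrK.
set X := t.+1%:R `^ (- gamma) in hH *.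
have -> : (t.+1%:R : R) `^ (- (2 * gamma)) = X ^+ 2.
  by rewrite -powR_mulrn ?powR_ge0// -powRrM; congr (_ `^ _); ring.
set D := _ `^ _ - _ => XD.
have X0 : 0 <= X := powR_ge0 _ _.
have H0 : 0 <= H.
  have Xgt0 : 0 < X by rewrite powR_gt0// ltr0n.
  by rewrite -(pmulr_lge0 _ Xgt0) (le_trans h0).
have ut : (U * t%:R `^ (- (3 * gamma - 1))) `^ theta <= 2 * U `^ theta * X.
  rewrite powRM ?powR_ge0// -powRrM -mulrA mulrCA ler_wpM2l ?powR_ge0//.
  rewrite mulNr [_ * theta]mulrC; apply: le_trans (powRN_le t0 gth) _.
  apply: le_trans (powRN_le_succ t0 (_ : 0 <= gamma)) _; first by lra.
  by rewrite ler_wpM2r// -[leRHS]powRr1// ler_powR//; lra.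
have K0 : 0 <= 2 * H * U `^ theta / C + E * H ^+ 2.
  by rewrite addr_ge0 ?mulr_ge0 ?sqr_ge0 ?powR_ge0// invr_ge0 ltW.
apply: (@le_trans _ _ ((2 * H * U `^ theta / C + E * H ^+ 2) * X ^+ 2)); last first.
  by rewrite -[leRHS]mulrA ler_wpM2l// ler_pdivlMl.
rewrite [leRHS]mulrDl lerD//; last first.
  by rewrite -[leRHS]mulrA ler_wpM2l// -exprMn ler_pXn2r ?nnegrE ?mulr_ge0//.
rewrite [leRHS]mulrAC ler_wpM2r ?invr_ge0 ?(ltW C0)//.
have := ler_pM h0 (powR_ge0 _ _) hH ut.
by rewrite (_ : H * X * _ = 2 * H * U `^ theta * X ^+ 2)//; ring.
Qed.

(** A barrier argument: were [phi] to cross [M * t^-p] at [t.+1], its drop in that step would be at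
    least the drop of the barrier, so it could not have crossed. *)
Lemma powRN_majorant (phi : nat -> R) (p q M : R) T : (0 < T)%N -> 0 <= p -> 0 <= M ->
  (forall t, (T <= t)%N ->
    p * t%:R `^ (- (p + 1)) <= q * t.+1%:R `^ (- (p + 1))) ->
  phi T <= M * T%:R `^ (- p) ->
  (forall t, (T <= t)%N -> M * t.+1%:R `^ (- p) < phi t.+1 ->
    phi t.+1 <= phi t - q * M * t.+1%:R `^ (- (p + 1))) ->
  forall t, (T <= t)%N -> phi t <= M * t%:R `^ (- p).
Proof.
move=> T0 p0 M0 pq phiT phiS; elim=> [|t IH]; first by rewrite leqNgt T0.
rewrite leq_eqVlt => /predU1P[<-//|Tt]; rewrite leNgt; apply/negP => lt.
have := phiS t Tt lt; have := IH Tt.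
have := powRN_decr_le (leq_trans T0 Tt) p0; have := pq t Tt.
move: lt; set x := t%:R `^ _; set y := t.+1%:R `^ _; set z := t%:R `^ _.
set w := t.+1%:R `^ _ => lt h1 h2 h3 h4.
have := ler_wpM2l M0 (le_trans h2 h1); lra.
Qed.

(** Above the barrier [M * t^-p] the KL inequality yields a drop of order [t^-(gamma + 2 theta p)],
    which is [t^-(p + 1)] by the balance of exponents. The condition on [M0] makes its coefficient
    at least [q * M], and [p <= 3 * gamma - 1] keeps the corrector below the barrier's order. *)
Lemma kl_rate gamma theta p q C U h0 T0 (phi a h s : nat -> R) :
  0 <= theta <= 1 -> 0 <= p < q -> p <= 3 * gamma - 1 ->
  gamma + 2 * theta * p = p + 1 -> 0 < C -> 0 <= U -> 0 < h0 ->
  (exists M0, forall M, M0 <= M -> q * M <= h0 / (8 * C ^+ 2) * M `^ (2 * theta)) ->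
  (forall t, (T0 <= t)%N -> [/\ 0 <= phi t, phi t.+1 <= phi t - h t.+1 / 2 * a t ^+ 2,
    h0 * t.+1%:R `^ (- gamma) <= h t.+1,
    phi t - U * t%:R `^ (- (3 * gamma - 1)) <= s t & s t `^ theta <= C * a t]) ->
  exists T M, forall t, (T <= t)%N -> phi t <= M * t%:R `^ (- p).
Proof.
move=> th01 pq pg gp C0 U0 h00 [M0 hM0] hyp.
have /andP[p0 _] := pq; have /andP[th0 _] := th01.
have [T1 hT1] := powRN_succ_ratio pq.
pose T := maxn (maxn T0 T1) 1.
have T_gt0 : (0 < T)%N by rewrite /T leq_max orbT.
have TT0 : (T0 <= T)%N by rewrite /T !leq_max leqnn.
have TT1 : (T1 <= T)%N by rewrite /T !leq_max leqnn orbT.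
(* In order: a large enough drop, a corrector of at most half the energy above the barrier ([2^p]
   pays for the shift to [t.+1]), nonnegativity, and the bound at the initial time [T]. *)
pose M := Num.max (Num.max M0 (2 * (2 `^ p * U))) (Num.max 0 (phi T * T%:R `^ p)).
have M_M0 : M0 <= M by rewrite /M !le_max lexx.
have M_U : 2 * (2 `^ p * U) <= M by rewrite /M !le_max lexx orbT.
have M_ge0 : 0 <= M by rewrite /M !le_max lexx orbT.
have M_T : phi T * T%:R `^ p <= M by rewrite /M !le_max lexx !orbT.
exists T, M; apply: (@powRN_majorant phi p q) => //.
- by move=> t Tt; apply: hT1; [exact: leq_trans Tt|exact: leq_trans Tt].
- by rewrite powRN ler_pdivlMr// powR_gt0// ltr0n.
move=> t Tt lt; have t0 : (0 < t)%N := leq_trans T_gt0 Tt.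
have [phi0 desc hh us sCa] := hyp t (leq_trans TT0 Tt).
have hS0 : 0 <= h t.+1 by apply: le_trans hh; rewrite mulr_ge0 ?powR_ge0 ?(ltW h00).
have phi_gt : M * t.+1%:R `^ (- p) <= phi t.
  have : 0 <= h t.+1 / 2 * a t ^+ 2 by rewrite mulr_ge0 ?sqr_ge0 ?divr_ge0.
  lra.
have u_le : U * t%:R `^ (- (3 * gamma - 1)) <= phi t / 2.
  have := ler_wpM2l U0 (le_trans (powRN_le t0 pg) (powRN_le_succ t0 p0)).
  have := ler_wpM2r (powR_ge0 (t.+1%:R : R) (- p)) M_U.
  lra.
have Ca := kl_dominant th01 phi0 us sCa u_le.
apply: le_trans desc _; rewrite lerD2l lerN2.
have Mt : M `^ theta * t.+1%:R `^ (- p * theta) <= phi t `^ theta.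
  rewrite powRrM -powRM ?powR_ge0//.
  by rewrite ge0_ler_powR ?nnegrE ?mulr_ge0 ?powR_ge0.
have a2 : M `^ (2 * theta) * t.+1%:R `^ (- (2 * theta * p)) / (4 * C ^+ 2)
    <= a t ^+ 2.
  rewrite ler_pdivrMr ?mulr_gt0 ?exprn_gt0//.
  have -> : M `^ (2 * theta) * t.+1%:R `^ (- (2 * theta * p)) =
      (M `^ theta * t.+1%:R `^ (- p * theta)) ^+ 2.
    rewrite exprMn -!powR_mulrn ?powR_ge0// -!powRrM.
    by congr (_ `^ _ * _ `^ _); ring.
  have -> : a t ^+ 2 * (4 * C ^+ 2) = (2 * (C * a t)) ^+ 2 by ring.
  have Ca0 : 0 <= C * a t := le_trans (powR_ge0 _ _) sCa.
  have MX0 : 0 <= M `^ theta * t.+1%:R `^ (- p * theta).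
    by rewrite mulr_ge0 ?powR_ge0.
  rewrite ler_pXn2r ?nnegrE //; lra.
have tS0 : (0 : R) < t.+1%:R by rewrite ltr0n.
have -> : (t.+1%:R : R) `^ (- (p + 1)) =
    t.+1%:R `^ (- gamma) * t.+1%:R `^ (- (2 * theta * p)).
  by rewrite -powRD ?(gt_eqF tS0) ?implybT// -gp opprD.
set X := t.+1%:R `^ (- gamma) in hh *; set Y := t.+1%:R `^ _ in a2 *.
have X0 : 0 <= X := powR_ge0 _ _.
have Y0 : 0 <= Y := powR_ge0 _ _.
have Z0 : 0 <= M `^ (2 * theta) * Y / (4 * C ^+ 2).
  by rewrite !mulr_ge0 ?powR_ge0// invr_ge0 mulr_ge0 ?sqr_ge0.
have hX0 : 0 <= h0 * X by rewrite mulr_ge0// ltW.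
have := ler_pM hX0 Z0 hh a2.
have := ler_wpM2r (mulr_ge0 X0 Y0) (hM0 M M_M0).
have -> : h0 / (8 * C ^+ 2) * M `^ (2 * theta) * (X * Y) =
  (h0 * X * (M `^ (2 * theta) * Y / (4 * C ^+ 2))) / 2 by field; rewrite gt_eqF.
lra.
Qed.

End KLRecursion.

(** * Cluster points and trapping of sequences *)

Section Subsequences.
Context {R : realType} {n : nat}.
Implicit Types (x : nat -> 'rV[R]_n) (p : 'rV[R]_n).

Lemma cluster_enorm x p (e : R) (T : nat) : cluster (x @ \oo) p -> 0 < e ->
  exists2 t, (T <= t)%N & enorm (x t - p) < e.
Proof.
move=> xp e0; have [] := xp [set y | exists2 t, (T <= t)%N & y = x t] _ _
  (enorm_nbhs p e0).
  by exists T => // t /= Tt; exists t.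
by move=> _ [[t Tt ->] xt]; exists t.
Qed.

Lemma bounded_seq_cluster x (M : R) : (forall t, (0 < t)%N -> `|x t| <= M) ->
  exists p, cluster (x @ \oo) p.
Proof.
move=> xM; have cB : compact [set y : 'rV[R]_n | `|y| <= M].
  apply: bounded_closed_compact; last first.
    apply: (preimage_closed _ (@closed_le _ _)) => y _; exact: norm_continuous.
  by exists M; split; [exact: num_real|move=> r Mr y /= yM; exact: le_trans (ltW Mr)].
have [|p [_ px]] := cB (x @ \oo) _; last by exists p.
by exists 1%N => // t /= t0; exact: xM.
Qed.

Lemma cvg_of_enorm x p : (forall e : R, 0 < e -> exists T, forall t, (T <= t)%N ->
  enorm (x t - p) < e) -> x @ \oo --> p.
Proof.
move=> xp; apply/cvgrPdist_lt => e e0; have [T hT] := xp e e0.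
exists T => // t /= Tt; rewrite distrC.
exact: le_lt_trans (norm_le_enorm _) (hT t Tt).
Qed.

(* Once the sequence enters the ball with [V] small, the telescoping bound on
   the steps prevents it from leaving. *)
Lemma trapped_cvg x p (V : nat -> R) (r : R) T : 0 < r ->
  (forall t, (T <= t)%N -> 0 <= V t) ->
  (forall e : R, 0 < e -> exists N, forall t, (N <= t)%N -> V t < e) ->
  (forall t, (T <= t)%N -> enorm (x t - p) < r ->
    enorm (x t.+1 - x t) <= V t - V t.+1) ->
  (forall e N, 0 < e -> exists2 t, (N <= t)%N & enorm (x t - p) < e) ->
  exists T', forall t, (T' <= t)%N -> enorm (x t - p) <= V t.
Proof.
move=> r0 V0 Vlt xV xp; have r2 : 0 < r / 2 by rewrite divr_gt0.
have [N hN] := Vlt _ r2; have [t0] := xp (r / 2) (maxn N T) r2.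
rewrite geq_max => /andP[Nt0 Tt0] xt0; have {hN}Vt0 := hN _ Nt0.
(* Staying in the ball and the telescoped bound are proved together: the start is within [r / 2] of
   [p], and the total displacement is at most [V t0 < r / 2]. *)
have path k : enorm (x (t0 + k)%N - p) < r /\
    enorm (x (t0 + k)%N - x t0) <= V t0 - V (t0 + k)%N.
  elim: k => [|k [IHr IHV]].
    by rewrite addn0 !subrr enorm0; split=> //; lra.
  have Tk : (T <= t0 + k)%N by rewrite (leq_trans Tt0) ?leq_addr.
  have step := xV _ Tk IHr; rewrite addnS.
  have dV : enorm (x (t0 + k).+1 - x t0) <= V t0 - V (t0 + k).+1.
    rewrite -[x _.+1](subrK (x (t0 + k)%N)) -addrA.
    apply: le_trans (enormD _ _) _; lra.
  split=> //; rewrite -[x _.+1](subrK (x t0)) -addrA.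
  apply: le_lt_trans (enormD _ _) _.
  have : 0 <= V (t0 + k).+1 by exact/V0/leqW.
  lra.
have xS t : (t0 <= t)%N -> enorm (x t.+1 - x t) <= V t - V t.+1.
  move=> tt; apply: xV; first exact: leq_trans tt.
  by have [] := path (t - t0)%N; rewrite subnKC.
have tail t k : (t0 <= t)%N -> enorm (x (t + k)%N - x t) <= V t - V (t + k)%N.
  move=> tt; elim: k => [|k IH]; first by rewrite addn0 !subrr enorm0.
  rewrite addnS -[x _.+1](subrK (x (t + k)%N)) -addrA.
  apply: le_trans (enormD _ _) _.
  have := xS (t + k)%N (leq_trans tt (leq_addr _ _)); lra.
(* Compare [x t] with a later iterate [x s] within [e] of [p]; the tail bound is uniform in [s]. *)
exists t0 => t tt; apply/ler_addgt0Pl => e e0.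
have [s ts xs] := xp e t e0.
have := tail t (s - t)%N tt; rewrite subnKC// => xst.
have Vs : 0 <= V s by apply: V0; rewrite (leq_trans Tt0) ?(leq_trans tt).
rewrite -[x t](subrK (x s)) -addrA; apply: le_trans (enormD _ _) _.
rewrite enormB; lra.
Qed.

End Subsequences.

(** * Derivative-free local form of the KL inequality *)

Section LocalKL.
Context {R : realType} {n : nat}.
Variables (F : 'rV[R]_n -> R) (p : 'rV[R]_n).
Hypothesis cF : {for p, continuous F}.

Lemma derive1_lojasiewicz (c theta s : R) : 0 < s ->
  (lojasiewicz c theta)^`()%classic s = c * ((1 - theta) * s `^ (- theta)).
Proof.
move=> s0; rewrite derive1E.
have := is_deriveZ c (is_derive1_powR (1 - theta) s0).
rewrite addrAC subrr add0r => -[_]; exact.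
Qed.

Lemma continuous_enorm (e : R) : 0 < e ->
  exists2 r, 0 < r & forall y, enorm (y - p) < r -> `|F y - F p| < e.
Proof.
move=> e0; apply: nbhs_enorm; have /cvgrPdist_lt /(_ e e0) := cF.
by apply: filterS => y; rewrite distrC.
Qed.

(** Write [s^theta'] as [s^(theta' - theta) * s^theta]. If [theta' > theta], the first factor is as
    small as desired near [p], so any [C > 0] works; only for equal exponents must [C] dominate
    [c * (1 - theta)]. *)
Lemma KL_exponent_local (rho : R -> R) (c theta theta' C : R) :
  (forall s, 0 <= s -> rho s = lojasiewicz c theta s) ->
  KL_inequality F rho p -> 0 < c -> 0 <= theta <= theta' -> 0 < theta' < 1 ->
  0 < C -> (theta' = theta -> c * (1 - theta) <= C) ->
  exists2 r, 0 < r & forall y, enorm (y - p) < r ->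
    `|F y - F p| `^ theta' <= C * enorm (grad F y).
Proof.
move=> rhoE [eta [U [eta0 /nbhs_enorm[r1 r10 r1U] KL]]] c0 /andP[th0 thth'].
move=> /andP[th'0 th'1] C0 Cc; have c1 : 0 < c * (1 - theta).
  by rewrite mulr_gt0// subr_gt0 (le_lt_trans thth').
have [d d0 hd] : exists2 d, 0 < d &
    forall s, 0 < s -> s < d -> c * (1 - theta) * s `^ (theta' - theta) <= C.
  move: thth'; rewrite le_eqVlt => /predU1P[thE|thlt].
    by exists 1 => // s _ _; rewrite -thE subrr powRr0 mulr1 Cc// thE.
  have [||d d0 hd] := @powR_cvg0_near R (theta' - theta) (C / (c * (1 - theta))).
  - by rewrite subr_gt0.
  - by rewrite divr_gt0.
  exists d => // s s0 sd; rewrite mulrC -ler_pdivlMr//.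
  by rewrite ltW// hd// ltW.
have [e [e0 ed eeta]] : exists e : R, [/\ 0 < e, e <= d & (e%:E <= eta)%E].
  case: eta eta0 {KL} => [s| |]//; rewrite ?lte_fin => s0; last by exists d; rewrite leey.
  by exists (Num.min s d); rewrite lt_min s0 d0 lee_fin !ge_min !lexx orbT.
have [r2 r20 r2F] := continuous_enorm e0.
exists (Num.min r1 r2) => [|y]; first by rewrite lt_min r10 r20.
rewrite lt_min => /andP[/r1U Uy /r2F Fy].
(* The KL inequality is silent where [F y = F p]; there [theta' > 0] matters, since zero to the
   power zero is one. *)
have [s0|sn0] := eqVneq `|F y - F p| 0.
  by rewrite s0 powR0 ?gt_eqF// mulr_ge0 ?enorm_ge0// ltW.
have {sn0}s0 : 0 < `|F y - F p| by rewrite lt0r sn0 normr_ge0.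
have := KL y Uy s0 (lt_le_trans _ eeta); rewrite lte_fin => /(_ Fy).
set s := `|F y - F p| in Fy s0 *.
(* [rho] is prescribed only on nonnegative reals, but [s > 0] has a neighborhood inside them, so the
   derivatives agree. *)
have -> : rho^`()%classic s = c * ((1 - theta) * s `^ (- theta)).
  rewrite -(derive1_lojasiewicz c theta s0) !derive1E; apply: near_eq_derive.
  near=> z; apply: rhoE; near: z; exact: lt_le_nbhsr.
have sth : 0 < s `^ theta by rewrite powR_gt0.
rewrite powRN => KLs.
have gth : s `^ theta <= c * (1 - theta) * enorm (grad F y).
  have := ler_wpM2l (ltW sth) KLs; rewrite mulr1 => /le_trans; apply.
  rewrite le_eqVlt; apply/orP; left; apply/eqP; field; exact: lt0r_neq0.
have -> : s `^ theta' = s `^ (theta' - theta) * s `^ theta.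
  by rewrite -powRD ?subrK// (gt_eqF s0) implybT.
apply: le_trans (ler_wpM2l (powR_ge0 _ _) gth) _.
rewrite mulrA ler_wpM2r ?enorm_ge0// mulrC hd//; exact: lt_le_trans ed.
Unshelve. all: by end_near. Qed.

End LocalKL.

(** * Construction of the nonincreasing energy *)

Section Energy.
Context {R : realType}.

Lemma powRN_lt_near (r e : R) : 0 < r -> 0 < e ->
  exists T, forall t, (T <= t)%N -> t%:R `^ (- r) < e.
Proof.
move=> r0 e0; have [d d0 hd] := powR_cvg0_near r0 e0.
exists (Num.bound d^-1).+1 => t Tt.
have dt : d^-1 < t%:R.
  apply: lt_le_trans (archi_boundP (ltW _)) _; first by rewrite invr_gt0.
  by rewrite ler_nat ltnW.
have t0 : (0 : R) < t%:R by apply: lt_trans dt; rewrite invr_gt0.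
have -> : t%:R `^ (- r) = (t%:R^-1) `^ r :> R.
  by rewrite -powR_inv1 ?(ltW t0)// -powRrM mulN1r.
by apply: hd; [rewrite invr_ge0 ltW|rewrite invf_plt].
Qed.

(** The corrected value [w] is nonincreasing and bounded below, so it converges. The corrector
    vanishes in the limit, so [v] has the same limit, and a monotone sequence stays above its
    limit. *)
Lemma energy_limit (gamma E H m : R) (v a h : nat -> R) T :
  1 / 2 < gamma -> 0 <= E -> 0 <= H ->
  (forall t, (T <= t)%N -> [/\ m <= v t,
     v t.+1 <= v t - h t.+1 / 2 * a t ^+ 2 + E * h t.+1 ^+ 3 &
     0 <= h t.+1 <= H * t.+1%:R `^ (- gamma)]) ->
  exists vs U T', [/\ 0 <= U,
    forall e, 0 < e -> exists N, forall t, (N <= t)%N -> `|v t - vs| < e &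
    forall t, (T' <= t)%N ->
      let phi t := v t - vs + U * t%:R `^ (- (3 * gamma - 1)) in
      0 <= phi t /\ phi t.+1 <= phi t - h t.+1 / 2 * a t ^+ 2].
Proof.
move=> g12 E0 H0 hyp; have r0 : 0 < 3 * gamma - 1 by lra.
(* With this [U], one decrement of the corrector covers the cubic error, of order [t^-(3 gamma)]. *)
pose U := E * H ^+ 3 / (3 * gamma - 1).
have U0 : 0 <= U by rewrite divr_ge0 ?(ltW r0)// mulr_ge0 ?exprn_ge0.
pose T' := maxn T 1; have T'T : (T <= T')%N by rewrite leq_maxl.
have T'0 : (0 < T')%N by rewrite leq_max orbT.
pose w t := v t + U * t%:R `^ (- (3 * gamma - 1)).
have wS t : (T' <= t)%N -> w t.+1 <= w t - h t.+1 / 2 * a t ^+ 2.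
  move=> tt; have [_ desc /andP[h0 hH]] := hyp t (leq_trans T'T tt).
  have h3 : E * h t.+1 ^+ 3 <= E * H ^+ 3 * t.+1%:R `^ (- (3 * gamma)).
    rewrite -mulrA ler_wpM2l//.
    have -> : - (3 * gamma) = - gamma * 3%:R by ring.
    rewrite powRrM powR_mulrn ?powR_ge0// -exprMn.
    by rewrite ler_pXn2r ?nnegrE// mulr_ge0 ?powR_ge0.
  have := powRN_decr_ge (leq_trans T'0 tt) (ltW r0).
  move=> /(ler_wpM2l U0); rewrite subrK mulrA divfK ?gt_eqF// /w; lra.
have w_dec t k : (T' <= t)%N -> w (t + k)%N <= w t.
  move=> tt; elim: k => [|k]; first by rewrite addn0.
  apply: le_trans; rewrite addnS; have tk := leq_trans tt (leq_addr k t).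
  have [_ _ /andP[h0 _]] := hyp _ (leq_trans T'T tk).
  apply: le_trans (wS _ tk) _.
  have : 0 <= h (t + k).+1 / 2 * a (t + k)%N ^+ 2.
    by rewrite mulr_ge0 ?sqr_ge0 ?divr_ge0.
  lra.
have w_m t : (T' <= t)%N -> m <= w t.
  move=> tt; have [mv _ _] := hyp t (leq_trans T'T tt).
  by rewrite ler_wpDr// mulr_ge0 ?powR_ge0.
pose ws k := w (k + T')%N.
have ws_dec : nonincreasing_seq ws.
  by move=> i j ij; rewrite /ws -(subnKC ij) addnAC w_dec// leq_addl.
have ws_cvg : cvgn ws.
  apply: nonincreasing_is_cvgn => //; exists m => _ [k _ <-].
  by apply: w_m; rewrite leq_addl.
have ws_ge k := nonincreasing_cvgn_ge ws_dec ws_cvg k.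
exists (limn ws), U, T'; split=> // [e e0|t tt /=].
  have e2 : 0 < e / 2 by rewrite divr_gt0.
  have [N1 _ hN1] := (cvgrPdist_lt _ _).1 ws_cvg _ e2.
  have [|N2 hN2] := @powRN_lt_near (3 * gamma - 1) (e / 2 / (U + 1)) r0.
    by rewrite divr_gt0// ltr_wpDl.
  exists (maxn (N1 + T') N2) => t; rewrite geq_max => /andP[N1t N2t].
  have tt : (T' <= t)%N by apply: leq_trans N1t; rewrite leq_addl.
  have := hN1 (t - T')%N; rewrite /= leq_subRL// addnC => /(_ N1t).
  rewrite /ws subnK// distrC /w => vt.
  have := hN2 t N2t; rewrite ltr_pdivlMr ?ltr_wpDl// => Ut.
  have P0 := powR_ge0 (t%:R : R) (- (3 * gamma - 1)).
  have UP0 := mulr_ge0 U0 P0.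
  move: vt; rewrite !ltr_norml => /andP[? ?]; apply/andP; split; lra.
have := ws_ge (t - T')%N; rewrite /ws subnK// => wt.
have := wS t tt; move: wt; rewrite /w; split; lra.
Qed.

End Energy.

(** * Convergence, rates and stationarity for an abstract descent sequence *)

Section Trajectory.
Context {R : realType} {n : nat}.
Variables (F : 'rV[R]_n -> R) (x : nat -> 'rV[R]_n) (h : nat -> R).
Variables (gamma Fs U H h0 E : R) (T : nat).

Let a t := enorm (grad F (x t)).
Let phi t := F (x t) - Fs + U * t%:R `^ (- (3 * gamma - 1)).

Hypotheses (gamma12 : 1 / 2 < gamma) (gamma1 : gamma <= 1).
Hypotheses (U0 : 0 <= U) (E0 : 0 <= E) (h00 : 0 < h0).
Hypothesis F_lim : forall e, 0 < e ->
  exists N, forall t, (N <= t)%N -> `|F (x t) - Fs| < e.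
Hypothesis phi_drop : forall t, (T <= t)%N ->
  0 <= phi t /\ phi t.+1 <= phi t - h t.+1 / 2 * a t ^+ 2.
Hypothesis h_bounds : forall t, (T <= t)%N ->
  h0 * t.+1%:R `^ (- gamma) <= h t.+1 <= H * t.+1%:R `^ (- gamma).
Hypothesis step_le : forall t, (T <= t)%N ->
  enorm (x t.+1 - x t) <= h t.+1 * a t + E * h t.+1 ^+ 2.

Lemma h_ge0 t : (T <= t)%N -> 0 <= h t.+1.
Proof.
move=> /h_bounds /andP[hh _]; apply: le_trans hh.
by rewrite mulr_ge0 ?powR_ge0// ltW.
Qed.

Lemma phi_lt e : 0 < e -> exists N, forall t, (N <= t)%N -> phi t < e.
Proof.
move=> e0; have e2 : 0 < e / 2 by rewrite divr_gt0.
have r0 : 0 < 3 * gamma - 1 by move: gamma12; lra.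
have [N1 hN1] := F_lim e2.
have [|N2 hN2] := @powRN_lt_near R (3 * gamma - 1) (e / 2 / (U + 1)) r0.
  by rewrite divr_gt0// ltr_wpDl.
exists (maxn N1 N2) => t; rewrite geq_max => /andP[/hN1 Ft /hN2].
rewrite ltr_pdivlMr ?ltr_wpDl// => Ut; rewrite /phi.
have P0 := powR_ge0 (t%:R : R) (- (3 * gamma - 1)).
move: Ft; rewrite ltr_norml => /andP[? ?]; lra.
Qed.

Lemma cluster_value p : {for p, continuous F} -> cluster (x @ \oo) p -> F p = Fs.
Proof.
move=> cF xp; apply/eqP; rewrite -subr_eq0 -normr_le0.
apply/ler_addgt0Pl => e e0; have e2 : 0 < e / 2 by rewrite divr_gt0.
have [N hN] := F_lim e2; have [r r0 rF] := continuous_enorm cF e2.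
have [t /hN Ft /rF Fp] := cluster_enorm N xp r0.
rewrite addr0 -[F p](subrK (F (x t))) -addrA; apply: le_trans (ler_normD _ _) _.
rewrite distrC; lra.
Qed.

Section LocalKLInequality.
Variables (theta C r : R) (p : 'rV[R]_n).
Hypotheses (theta01 : 0 < theta < 1) (C0 : 0 < C) (r0 : 0 < r).
Hypothesis gamma_theta : gamma <= theta * (3 * gamma - 1).
Hypothesis cF : {for p, continuous F}.
Hypothesis xp : cluster (x @ \oo) p.
Hypothesis KLp : forall y, enorm (y - p) < r ->
  `|F y - F p| `^ theta <= C * enorm (grad F y).

Lemma kl_majorant_lt K W e : 0 <= K -> 0 <= W -> 0 < e ->
  exists N, forall t, (N <= t)%N ->
    K * phi t `^ (1 - theta) + W * t%:R `^ (- (2 * gamma - 1)) < e.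
Proof.
move=> K0 W0 e0; have /andP[th0 th1] := theta01.
have rho0 : 0 < 2 * gamma - 1 by move: gamma12; lra.
have eta0 : 0 < 1 - theta by lra.
have [||d d0 hd] := @powR_cvg0_near R (1 - theta) (e / 2 / (K + 1)) => //.
  by rewrite !divr_gt0// ltr_wpDl.
have [N1 hN1] := phi_lt d0.
have [|N2 hN2] := @powRN_lt_near R (2 * gamma - 1) (e / 2 / (W + 1)) rho0.
  by rewrite !divr_gt0// ltr_wpDl.
exists (maxn (maxn N1 N2) T) => t; rewrite !geq_max => /andP[/andP[/hN1 N1t /hN2]].
rewrite ltr_pdivlMr ?ltr_wpDl// => Wt /phi_drop[phi0 _].
have := hd _ phi0 N1t; rewrite ltr_pdivlMr ?ltr_wpDl// => Kt.
have P0 := powR_ge0 (t%:R : R) (- (2 * gamma - 1)).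
have Q0 := powR_ge0 (phi t) (1 - theta).
lra.
Qed.

(** This is [trapped_cvg] with potential [V]: its [K] term pays for the KL part of a step by
    [kl_step], its [W] term for the noise by [noise_telescopes]. *)
Lemma kl_distance : exists K W N, [/\ 0 <= K, 0 <= W &
  forall t, (N <= t)%N ->
    enorm (x t - p) <= K * phi t `^ (1 - theta) + W * t%:R `^ (- (2 * gamma - 1))].
Proof.
have /andP[th0 th1] := theta01; have FpFs := cluster_value cF xp.
have rho0 : 0 < 2 * gamma - 1 by move: gamma12; lra.
have eta0 : 0 < 1 - theta by lra.
pose T' := maxn T 1; have TT : (T <= T')%N by rewrite leq_maxl.
have T'0 : (0 < T')%N by rewrite leq_max orbT.
pose K := 4 * C / (1 - theta).
have K0 : 0 <= K by rewrite divr_ge0 ?(ltW eta0)// mulr_ge0// ltW.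
have H0 : 0 <= H.
  have /andP[hh hH] := h_bounds (leqnn T).
  have P0 : 0 < T.+1%:R `^ (- gamma) :> R by rewrite powR_gt0// ltr0n.
  by rewrite -(pmulr_lge0 _ P0) (le_trans _ hH)// h_ge0.
pose W := (2 * H * U `^ theta / C + E * H ^+ 2) / (2 * gamma - 1).
have W0 : 0 <= W.
  apply: divr_ge0 (ltW rho0); apply: addr_ge0; last by rewrite mulr_ge0 ?sqr_ge0.
  by rewrite divr_ge0 ?(ltW C0)// !mulr_ge0 ?powR_ge0.
pose V t := K * phi t `^ (1 - theta) + W * t%:R `^ (- (2 * gamma - 1)).
have [|e e0|t tt xt|e N e0|N hN] := @trapped_cvg R n x p V r T' r0.
- by move=> t _; apply: addr_ge0; apply: mulr_ge0; rewrite ?powR_ge0.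
- exact: kl_majorant_lt.
- have Tt := leq_trans TT tt; have t0 := leq_trans T'0 tt.
  have [phi0 drop] := phi_drop Tt; have /andP[_ hH] := h_bounds Tt.
  have [phi'0 _] := phi_drop (leqW Tt); have hS0 := h_ge0 Tt.
  have ut0 : 0 <= U * t%:R `^ (- (3 * gamma - 1)) by rewrite mulr_ge0 ?powR_ge0.
  have us : phi t - U * t%:R `^ (- (3 * gamma - 1)) <= `|F (x t) - F p|.
    by rewrite addrK FpFs ler_norm.
  have kl := kl_step theta01 C0 hS0 (enorm_ge0 _) phi'0 ut0 drop us (KLp xt).
  have gamma_bounds : 1 / 2 < gamma <= 1 by rewrite gamma12.
  apply: le_trans (step_le Tt) _.
  have VB A A' X X' : K * A + W * X - (K * A' + W * X') = K * (A - A') + W * (X - X').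
    by rewrite !mulrBr opprD addrACA.
  rewrite /V VB.
  apply: le_trans (lerD kl (lexx _)) _; rewrite -addrA lerD2l.
  exact: (noise_telescopes gamma_bounds (ltW th0) gamma_theta C0 U0 E0 t0 hS0 hH).
- exact: cluster_enorm N xp e0.
by exists K, W, N; split.
Qed.

Lemma kl_cvg e : 0 < e -> exists N, forall t, (N <= t)%N -> enorm (x t - p) < e.
Proof.
move=> e0; have [K [W [N1 [K0 W0 hN1]]]] := kl_distance.
have [N2 hN2] := kl_majorant_lt K0 W0 e0.
exists (maxn N1 N2) => t; rewrite geq_max => /andP[/hN1 xt /hN2].
exact: le_lt_trans.
Qed.

(** [kl_rate] bounds the energy by [t^-s]; the condition [(1 - theta) * s <= 2 * gamma - 1] says
    that the [W] term decays at least as fast as the resulting energy term. *)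
Lemma kl_distance_rate q s : 0 <= s < q -> s <= 3 * gamma - 1 ->
  gamma + 2 * theta * s = s + 1 -> (1 - theta) * s <= 2 * gamma - 1 ->
  (exists M0, forall M, M0 <= M -> q * M <= h0 / (8 * C ^+ 2) * M `^ (2 * theta)) ->
  exists N D, forall t, (N <= t)%N ->
    enorm (x t - p) <= D * t%:R `^ (- ((1 - theta) * s)).
Proof.
move=> sq sg gs sth hM0; have /andP[th0 th1] := theta01.
have th01 : 0 <= theta <= 1 by rewrite !ltW.
have FpFs := cluster_value cF xp.
have [K [W [N1 [K0 W0 hN1]]]] := kl_distance.
have [N2 hN2] := kl_cvg r0.
have [|N3 [M hM]] := @kl_rate R gamma theta s q C U h0 (maxn T N2) phi a h
    (fun t => `|F (x t) - F p|) th01 sq sg gs C0 U0 h00 hM0.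
  move=> t; rewrite geq_max => /andP[Tt /hN2 xt].
  have [phi0 drop] := phi_drop Tt; have /andP[hh _] := h_bounds Tt.
  by split=> //; [rewrite addrK FpFs ler_norm|exact: KLp].
(* The absolute value is there because [kl_rate] gives no sign for [M]. *)
exists (maxn (maxn N1 N3) (maxn T 1)), (K * `|M| `^ (1 - theta) + W) => t.
rewrite !geq_max => /andP[/andP[N1t N3t]] /andP[Tt t0].
apply: le_trans (hN1 t N1t) _; rewrite [leRHS]mulrDl lerD//; last first.
  by rewrite ler_wpM2l// powRN_le.
rewrite -mulrA ler_wpM2l//; have [phi0 _] := phi_drop Tt.
have -> : - ((1 - theta) * s) = - s * (1 - theta) by ring.
rewrite powRrM -powRM ?powR_ge0// ge0_ler_powR ?nnegrE ?mulr_ge0 ?powR_ge0//.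
  by rewrite subr_ge0 ltW.
by apply: le_trans (hM t N3t) _; rewrite ler_wpM2r ?powR_ge0 ?ler_norm.
Qed.

End LocalKLInequality.

(* With a nonzero limiting gradient the energy would drop by a fixed amount
   between [t] and [2 t], the step sizes being at least of order [1 / t]. *)
Lemma limit_stationary L p : 0 < L -> lipschitz_grad L F ->
  (forall e, 0 < e -> exists N, forall t, (N <= t)%N -> enorm (x t - p) < e) ->
  stationary F p.
Proof.
move=> L0 FL xp; apply: enorm_eq0; apply/eqP; apply: contraT => dn0.
set d := enorm _ in dn0; have d0 : 0 < d by rewrite lt0r dn0 enorm_ge0.
(* Within this radius the Lipschitz bound keeps the gradient norm at least [d / 2]. *)
have [|N1 hN1] := xp (d / 2 / L); first by rewrite !divr_gt0.
have ad t : (N1 <= t)%N -> d / 2 <= a t.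
  move=> /hN1; rewrite (ltr_pdivlMr _ _ L0) => xt.
  have := FL p (x t); rewrite [enorm (p - _)]enormB => gp.
  have := enormD (grad F (x t)) (grad F p - grad F (x t)).
  rewrite addrC subrK -/d -/(a t); lra.
pose k := h0 * (d / 2) ^+ 2 / 2.
have k0 : 0 < k by rewrite divr_gt0// mulr_gt0// exprn_gt0// divr_gt0.
pose N := maxn (maxn N1 T) 1.
have N_N1 : (N1 <= N)%N by rewrite !leq_max leqnn.
have N_T : (T <= N)%N by rewrite !leq_max leqnn orbT.
have N0 : (0 < N)%N by rewrite leq_max orbT.
have drop t : (N <= t)%N -> phi t.+1 <= phi t - k / t.+1%:R.
  move=> Nt; have Tt := leq_trans N_T Nt; have [_ /le_trans] := phi_drop Tt; apply.
  rewrite lerD2l lerN2; have /andP[hh _] := h_bounds Tt.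
  have tS : t.+1%:R^-1 <= t.+1%:R `^ (- gamma) :> R.
    by rewrite -powR_inv1// ler_powR ?ler1n// lerN2.
  have ht : h0 / t.+1%:R <= h t.+1.
    by apply: le_trans hh; rewrite ler_wpM2l// ltW.
  have a2 : (d / 2) ^+ 2 <= a t ^+ 2.
    have := ad t (leq_trans N_N1 Nt) => ?.
    by rewrite ler_pXn2r ?nnegrE ?enorm_ge0 ?divr_ge0 ?(ltW d0).
  have := ler_pM _ _ ht a2; rewrite sqr_ge0 divr_ge0 ?(ltW h00)// => /(_ isT isT).
  rewrite /k; set i := _^-1; lra.
(* Each of the [t] steps up to [2 t] loses at least [k / (2 t)], hence [k / 2] in total, while [phi]
   is nonnegative and tends to zero. *)
have half t j : (N <= t)%N -> (j <= t)%N ->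
    phi (t + j)%N <= phi t - j%:R * (k / (2 * t%:R)).
  move=> Nt; elim: j => [|j IH] jt; first by rewrite addn0 mul0r subr0.
  have := drop (t + j)%N (leq_trans Nt (leq_addr _ _)); have := IH (ltnW jt).
  rewrite -[j.+1%:R]natr1 addnS.
  have : k / (2 * t%:R) <= k / (t + j).+1%:R.
    rewrite ler_wpM2l ?(ltW k0)// lef_pV2 ?posrE ?mulr_gt0 ?ltr0n//.
      by rewrite -natrM ler_nat mul2n -addnn ltn_add2l.
    exact: leq_trans Nt.
  set c := k / (2 * _); set c' := k / _; set v := phi (t + j)%N.
  set v' := phi (t + j).+1; set w := phi t; clearbody c c' v v' w; lra.
have [|N2 hN2] := @phi_lt (k / 2); first by rewrite divr_gt0.
pose t := maxn N N2; have Nt : (N <= t)%N by rewrite leq_maxl.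
have t0 : (0 : R) < t%:R by rewrite ltr0n (leq_trans N0).
have := half t t Nt (leqnn t); have := hN2 t (leq_maxr _ _).
have -> : t%:R * (k / (2 * t%:R)) = k / 2 by field; rewrite gt_eqF.
have [+ _] := phi_drop (leq_trans N_T (leq_trans Nt (leq_addr t t))).
lra.
Qed.

End Trajectory.

(** * Step sizes and the estimates for the reshuffling iteration *)

Section StepSizes.
Context {R : realType}.
Variables (N : nat) (alpha beta gamma : R).
Hypotheses (N0 : (0 < N)%N) (alpha0 : 0 < alpha) (beta0 : 0 <= beta).
Hypotheses (gamma0 : 0 < gamma) (gamma1 : gamma <= 1).

Lemma step_size_le t : (0 < t)%N ->
  0 <= step_size alpha beta gamma t <= alpha * t%:R `^ (- gamma).
Proof.
move=> t0; have tb : (0 : R) < t%:R + beta by rewrite ltr_wpDr// ltr0n.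
rewrite /step_size divr_ge0 ?powR_ge0 ?(ltW alpha0)//= powRN.
rewrite ler_wpM2l ?(ltW alpha0)// lef_pV2 ?posrE ?powR_gt0 ?ltr0n//.
by rewrite ge0_ler_powR ?nnegrE ?(ltW gamma0) ?(ltW tb)// lerDl.
Qed.

(** Once [beta <= t], the base is at most [2 * t], and [gamma <= 1] bounds the factor [2^gamma] by
    2. *)
Lemma step_size_ge t : (0 < t)%N -> beta <= t%:R ->
  alpha / 2 * t%:R `^ (- gamma) <= step_size alpha beta gamma t.
Proof.
move=> t0 bt; have tb : (0 : R) < t%:R + beta by rewrite ltr_wpDr// ltr0n.
rewrite /step_size powRN -mulrA -invfM ler_wpM2l ?(ltW alpha0)//.
rewrite lef_pV2 ?posrE ?mulr_gt0 ?powR_gt0 ?ltr0n//.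
apply: (@le_trans _ _ ((2 * t%:R) `^ gamma)).
  by rewrite ge0_ler_powR ?nnegrE ?(ltW gamma0) ?(ltW tb)//; lra.
by rewrite powRM// ler_wpM2r ?powR_ge0// -[leRHS]powRr1// ler_powR ?ler1n.
Qed.

End StepSizes.

Lemma rr_epoch {R : realType} {n N : nat} (f : 'I_N -> 'rV[R]_n -> R)
    (L M alpha beta gamma : R) (sigma : nat -> {perm 'I_N}) (x : nat -> 'rV[R]_n)
    (F := average f) (h := fun t => N%:R * step_size alpha beta gamma t) :
  (0 < N)%N -> 0 < L -> (forall i x, differentiable (f i) x) ->
  (forall i, bounded_below (f i)) -> (forall i, lipschitz_grad L (f i)) ->
  0 < alpha -> 0 <= beta -> 1 / 2 < gamma <= 1 ->
  rr_trajectory f (step_size alpha beta gamma) sigma x ->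
  (forall t, (0 < t)%N -> `|x t| <= M) ->
  exists T E m, 0 <= E /\ forall t, (T <= t)%N ->
    [/\ m <= F (x t),
        F (x t.+1) <= F (x t) - h t.+1 / 2 * enorm (grad F (x t)) ^+ 2
          + 5 / 4 * E ^+ 2 * h t.+1 ^+ 3,
        N%:R * alpha / 2 * t.+1%:R `^ (- gamma) <= h t.+1
          <= N%:R * alpha * t.+1%:R `^ (- gamma) &
        enorm (x t.+1 - x t) <= h t.+1 * enorm (grad F (x t)) + E * h t.+1 ^+ 2].
Proof.
move=> N0 L0 df fb fL alpha0 beta0 /andP[g12 g1] [xt hxt] xM.
have g0 : 0 < gamma by lra.
have N_gt0 : (0 : R) < N%:R by rewrite ltr0n.
have [m hm] := choice fb.
(* A common bound for all component gradients along the bounded sequence, by Lipschitz comparison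
   with the origin. *)
pose G := \sum_(i < N) enorm (grad (f i) 0) + L * ((1 + n%:R) * M).
have M0 : 0 <= M := le_trans (normr_ge0 _) (xM 1%N isT).
have G0 : 0 <= G.
  rewrite addr_ge0 ?mulr_ge0 ?(ltW L0) ?addr_ge0//.
  by apply: sumr_ge0 => i _; exact: enorm_ge0.
have gradG t i : (0 < t)%N -> enorm (grad (f i) (x t)) <= G.
  move=> /xM xtM; rewrite -[grad _ _](subrK (grad (f i) 0)) addrC.
  apply: le_trans (enormD _ _) _; apply: lerD.
    by rewrite (bigD1 i)//= lerDl; apply: sumr_ge0 => j _; exact: enorm_ge0.
  apply: le_trans (fL _ _ _) _; rewrite ler_wpM2l ?(ltW L0)// subr0.
  by apply: le_trans (enorm_le_norm _) _; rewrite ler_wpM2l// addr_ge0.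
(* From this time on [8 * L * h <= 1], as [perturbed_descent] requires. *)
have [|T hT] := @powRN_lt_near R gamma ((8 * L)^-1 / (N%:R * alpha)) g0.
  by rewrite divr_gt0 ?invr_gt0 ?mulr_gt0.
pose T' := maxn (maxn T (Num.bound beta)) 1.
exists T', (2 * L * G), (N%:R^-1 * \sum_(i < N) m i); split.
  by rewrite !mulr_ge0// ltW.
move=> t; rewrite !geq_max => /andP[/andP[Tt bt] t0].
have bt' : beta <= t.+1%:R.
  apply: le_trans (ltW (archi_boundP beta0)) _; rewrite ler_nat; exact: leqW.
have /andP[s0 sle] := step_size_le alpha0 beta0 g0 (ltn0Sn t).
have hle : h t.+1 <= N%:R * alpha * t.+1%:R `^ (- gamma).
  by rewrite -mulrA ler_wpM2l.
have h0 : 0 <= h t.+1 by rewrite mulr_ge0.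
have Lh : 8 * L * h t.+1 <= 1.
  have := hT t.+1 (leqW Tt); rewrite ltr_pdivlMr ?mulr_gt0// mulrC => /ltW hT'.
  have L8 : 0 < 8 * L by rewrite mulr_gt0.
  by rewrite mulrC -ler_pdivlMr// mul1r (le_trans hle).
have [x0 xS xN] := hxt t.+1 isT.
have aLN : 2 * L * h t.+1 <= 1.
  have := mulr_ge0 (ltW L0) h0; lra.
have gG i : enorm (grad (f i) (xt t.+1 0%N)) <= G by rewrite x0; exact: gradG.
have [e eE] := epoch_gradient_step (ltW L0) fL s0 aLN xS gG N0 df.
rewrite -xN x0 /= -/F -/(h t.+1) => xe.
have FL : lipschitz_grad L F by exact: lipschitz_grad_average.
have dF z : differentiable F z by exact: differentiable_average.
have E0 : 0 <= 2 * L * G by rewrite !mulr_ge0// ltW.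
split.
- by rewrite ler_pM2l ?invr_gt0//; apply: ler_sum => i _; exact: hm.
- rewrite xe; apply: le_trans (perturbed_descent _ _ (ltW L0) dF FL h0 Lh) _.
  rewrite lerD2l.
  have : enorm e ^+ 2 <= (2 * L * G * h t.+1) ^+ 2.
    by rewrite ler_pXn2r ?nnegrE ?enorm_ge0 ?(mulr_ge0 E0 h0).
  move=> /(ler_wpM2l h0); set E := 2 * L * G; set k := h t.+1.
  by clearbody E k; lra.
- rewrite hle andbT -[N%:R * alpha / 2]mulrA -[leLHS]mulrA ler_wpM2l//.
  exact: step_size_ge.
- rewrite xe addrAC subrr add0r enormN enormZ ger0_norm//.
  apply: le_trans (ler_wpM2l h0 (enormD _ _)) _; rewrite mulrDr lerD2l.
  by apply: le_trans (ler_wpM2l h0 eE) _; rewrite mulrCA -expr2.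
Qed.

(** This meets the condition on [M0] in [kl_rate] whenever [theta > 1 / 2], with no restriction on
    the constants. *)
Lemma le_powR_superlinear {R : realType} (q r theta : R) : 0 < q -> 0 < r ->
  1 / 2 < theta -> exists M0, forall M, M0 <= M -> q * M <= r * M `^ (2 * theta).
Proof.
move=> q0 r0 th; have k0 : 0 < 2 * theta - 1 by lra.
exists (Num.max 1 ((q / r) `^ (2 * theta - 1)^-1)) => M; rewrite ge_max => /andP[M1 Mq].
have M0 : 0 < M by lra.
have -> : M `^ (2 * theta) = M `^ (2 * theta - 1) * M.
  by rewrite [RHS]mulrC mulr_powRB1 ?(ltW M0)//; lra.
rewrite mulrA ler_wpM2r ?(ltW M0)// mulrC -ler_pdivrMr//.
have -> : q / r = ((q / r) `^ (2 * theta - 1)^-1) `^ (2 * theta - 1).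
  by rewrite -powRrM mulVf ?lt0r_neq0// powRr1// divr_ge0 ?ltW.
by rewrite ge0_ler_powR ?nnegrE ?powR_ge0 ?(ltW k0) ?(ltW M0).
Qed.

(** * Asymptotic notation and the convergence theorem *)

Lemma bigO_of_le {R : realType} (u v w : nat -> R) (D : R) N :
  (forall t, 0 <= u t) -> (forall t, (N <= t)%N -> u t <= D * v t) ->
  (forall t, (0 < t)%N -> v t = w t) -> (u =O_\oo w).
Proof.
move=> u0 uv vw; apply/eqO_exP; exists (1 + `|D|); first by rewrite ltr_pwDl.
exists (maxn N 1) => // t /=; rewrite geq_max => /andP[Nt t0].
rewrite ger0_norm// -vw//; apply: le_trans (uv t Nt) _.
apply: le_trans (ler_norm _) _; rewrite normrM ler_wpM2r//.
by rewrite lerDr.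
Qed.

Theorem theorem3p10 (R : realType) (n N : nat) (hN : (0 < N)%N)
    (f : 'I_N -> 'rV[R]_n -> R) (L : R) (hL : 0 < L)
    (hC1 : forall i, C1 (f i))
    (hbelow : forall i, bounded_below (f i))
    (hLip : forall i, lipschitz_grad L (f i))
    (alpha beta gamma : R)
    (halpha : 0 < alpha) (hbeta : 0 <= beta) (hgamma : 1 / 2 < gamma <= 1)
    (sigma : nat -> {perm 'I_N}) (x : nat -> 'rV[R]_n)
    (hx : rr_trajectory f (step_size alpha beta gamma) sigma x)
    (hbounded : [bounded x t | t in [set t : nat | (1 <= t)%N]])
    (hKL : forall xbar : 'rV[R]_n, cluster (x @ \oo) xbar ->
      exists2 rho, lojasiewicz_class rho & KL_inequality (average f) rho xbar) :
  exists xs : 'rV[R]_n,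
    [/\ x @ \oo --> xs,
        stationary (average f) xs &
        forall c theta : R, KL_exponent (average f) xs c theta ->
          [/\ gamma < 1 -> theta < gamma / (3 * gamma - 1) ->
                (fun t : nat => enorm (x t - xs)) =O_\oo
                (fun t : nat => t%:R `^ (- (2 * gamma - 1))),
              gamma < 1 -> gamma / (3 * gamma - 1) <= theta ->
                (fun t : nat => enorm (x t - xs)) =O_\oo
                (fun t : nat => t%:R `^
                   (- ((1 - theta) * (1 - gamma) / (2 * theta - 1)))) &
              theta <= 1 / 2 -> gamma = 1 -> alpha > 8 * c ^+ 2 / N%:R ->
                (fun t : nat => enorm (x t - xs)) =O_\oo
                (fun t : nat => (t%:R^-1 : R))]].

Proof.
have [g12 g1] := andP hgamma; have g0 : 0 < gamma by lra.
have N_gt0 : (0 : R) < N%:R by rewrite ltr0n.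
have df i z : differentiable (f i) z by have [] := hC1 i.
set F := average f in hKL *.
have dF z : differentiable F z by exact: differentiable_average.
have cF p : {for p, continuous F} by exact: differentiable_continuous.
have FL : lipschitz_grad L F by exact: lipschitz_grad_average.
have [M xM] : exists M, forall t, (0 < t)%N -> `|x t| <= M.
  have [M [_ hM]] := hbounded; exists (M + 1) => t t0.
  by apply: (hM (M + 1)); rewrite ?ltrDl.
have [T0 [E [m [E0 hyp]]]] := rr_epoch hN hL df hbelow hLip halpha hbeta hgamma hx xM.
set h := fun t => N%:R * step_size alpha beta gamma t in hyp.
have Na0 : 0 < N%:R * alpha by rewrite mulr_gt0.
have Na20 : 0 < N%:R * alpha / 2 by rewrite divr_gt0.
have [||t Tt|Fs [U [T1 [U0 F_lim drop]]]] := @energy_limit R gamma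
  (5 / 4 * E ^+ 2) (N%:R * alpha) m (fun t => F (x t))
  (fun t => enorm (grad F (x t))) h T0 g12.
- by rewrite mulr_ge0 ?sqr_ge0// divr_ge0.
- exact: ltW.
- have [mF desc /andP[hge hle] _] := hyp t Tt; split; [exact: mF|exact: desc|].
  apply/andP; split; last exact: hle.
  by apply: le_trans hge; rewrite mulr_ge0 ?powR_ge0// ltW.
pose T := maxn T0 T1.
have phi_drop t : (T <= t)%N ->
    let phi t := F (x t) - Fs + U * t%:R `^ (- (3 * gamma - 1)) in
    0 <= phi t /\ phi t.+1 <= phi t - h t.+1 / 2 * enorm (grad F (x t)) ^+ 2.
  by rewrite geq_max => /andP[_]; exact: drop.
have h_bounds t : (T <= t)%N -> N%:R * alpha / 2 * t.+1%:R `^ (- gamma) <= h t.+1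
    <= N%:R * alpha * t.+1%:R `^ (- gamma).
  by rewrite geq_max => /andP[Tt _]; have [] := hyp t Tt.
have step_le t : (T <= t)%N ->
    enorm (x t.+1 - x t) <= h t.+1 * enorm (grad F (x t)) + E * h t.+1 ^+ 2.
  by rewrite geq_max => /andP[Tt _]; have [] := hyp t Tt.
have thg0 : 0 < gamma / (3 * gamma - 1) by rewrite divr_gt0//; lra.
have thg1 : gamma / (3 * gamma - 1) < 1 by rewrite ltr_pdivrMr; lra.
have gammath th : gamma / (3 * gamma - 1) <= th -> gamma <= th * (3 * gamma - 1).
  by rewrite ler_pdivrMr//; lra.
have [xs xxs] := bounded_seq_cluster xM.
(* [th] is the given KL exponent; [th'] is the possibly larger one used in the estimates. *)
have rate c th th' C q s : KL_inequality F (lojasiewicz c th) xs -> 0 < c ->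
    0 <= th <= th' -> th' < 1 -> gamma / (3 * gamma - 1) <= th' -> 0 < C ->
    (th' = th -> c * (1 - th) <= C) ->
    0 <= s < q -> s <= 3 * gamma - 1 -> gamma + 2 * th' * s = s + 1 ->
    (1 - th') * s <= 2 * gamma - 1 ->
    (exists M0, forall M, M0 <= M ->
      q * M <= N%:R * alpha / 2 / (8 * C ^+ 2) * M `^ (2 * th')) ->
    exists N D, forall t, (N <= t)%N ->
      enorm (x t - xs) <= D * t%:R `^ (- ((1 - th') * s)).
  move=> KL c0 thth' th'1 gth' C0 Cc sq sg gs sth hM0.
  have th'01 : 0 < th' < 1 by rewrite th'1 andbT (lt_le_trans thg0).
  have [r r0 KLr] := KL_exponent_local (cF xs) (fun s _ => erefl) KL c0 thth' th'01 C0 Cc.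
  exact: (kl_distance_rate g12 g1 U0 E0 Na20 F_lim phi_drop h_bounds step_le
    th'01 C0 r0 (gammath _ gth') (cF xs) xxs KLr sq sg gs sth hM0).
have xs_lim : forall e, 0 < e -> exists N0, forall t, (N0 <= t)%N -> enorm (x t - xs) < e.
  have [rho [c [th [c0 /andP[th0 th1] rhoE]]] KL] := hKL xs xxs.
  (* The smallest exponent that is both admissible for the KL inequality and large enough for the
     noise to telescope. *)
  pose th' := Num.max th (gamma / (3 * gamma - 1)).
  have thth' : 0 <= th <= th' by rewrite th0 /th' le_max lexx.
  have gth' : gamma / (3 * gamma - 1) <= th' by rewrite /th' le_max lexx orbT.
  have th'01 : 0 < th' < 1 by rewrite (lt_le_trans thg0)//= /th' gt_max th1.
  have c1 : 0 < c * (1 - th) by rewrite mulr_gt0// subr_gt0.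
  have [r r0 KLr] := KL_exponent_local (cF xs) rhoE KL c0 thth' th'01 c1 (fun=> lexx _).
  exact: (kl_cvg g12 g1 U0 E0 Na20 F_lim phi_drop h_bounds step_le
    th'01 c1 r0 (gammath _ gth') (cF xs) xxs KLr).
have Fxs0 : stationary F xs.
  exact: (limit_stationary g12 g1 U0 Na20 F_lim phi_drop h_bounds hL FL xs_lim).
exists xs; split=> //; first exact: cvg_of_enorm.
move=> c theta [c0 /andP[th0 th1] KL]; have enorm_x t := enorm_ge0 (x t - xs).
(* The energy rate [s = (1 - gamma) / (2 * th' - 1)] solves [gamma + 2 * th' * s = s + 1]; for
   [gamma < 1] the threshold exceeds [1 / 2], so the denominator is positive. Any [q > s] would do,
   here [s + 1]. *)
have sublinear_rate th' : gamma < 1 -> gamma / (3 * gamma - 1) <= th' -> th' < 1 ->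
    theta <= th' -> exists N D, forall t, (N <= t)%N -> enorm (x t - xs) <=
      D * t%:R `^ (- ((1 - th') * ((1 - gamma) / (2 * th' - 1)))).
  move=> gl1 gth' th'1 thth'.
  have g3 := gammath _ gth'.
  have k0 : 0 < 2 * th' - 1 by nra.
  have s0 : 0 <= (1 - gamma) / (2 * th' - 1) by rewrite divr_ge0 ?(ltW k0)//; lra.
  have c1 : 0 < c * (1 - theta) by rewrite mulr_gt0// subr_gt0.
  have sE : (1 - gamma) / (2 * th' - 1) * (2 * th' - 1) = 1 - gamma.
    by rewrite divfK// gt_eqF.
  apply: (rate _ _ _ _ ((1 - gamma) / (2 * th' - 1) + 1) _ KL c0 _ th'1 gth' c1) => //.
  - by rewrite th0.
  - by rewrite s0 ltrDl ltr01.
  - by rewrite ler_pdivrMr//; lra.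
  - by move: sE; set s := _ / _; lra.
  - by rewrite mulrA ler_pdivrMr//; lra.
  - by apply: le_powR_superlinear; [lra|rewrite divr_gt0// mulr_gt0// exprn_gt0|lra].
split.
(* The exponent is raised to the threshold, where [s = 3 * gamma - 1] and
   [(1 - th') * s = 2 * gamma - 1]. *)
- move=> gl1 thlt; have [|n0 [D hD]] := sublinear_rate _ gl1 (lexx _) thg1.
    exact: ltW.
  apply: bigO_of_le enorm_x hD _ => t t0; congr (_ `^ (- _)).
  by field; lra.
- move=> gl1 thge; have [n0 [D hD]] := sublinear_rate _ gl1 thge th1 (lexx _).
  by apply: bigO_of_le enorm_x hD _ => t t0; rewrite mulrA.
- move=> th12 g1E alphac.
  have c20 : 0 < c / 2 by rewrite divr_gt0.
  have Nalpha : 8 * c ^+ 2 < N%:R * alpha.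
    by move: alphac; rewrite ltr_pdivrMr// [alpha * _]mulrC.
  have c2 : 0 < c ^+ 2 by rewrite exprn_gt0.
  (* For [gamma = 1] the threshold is [1 / 2], the energy rate is [s = 2], and [C = c / 2] is
     [c * (1 - theta)] at [theta = 1 / 2]. The drop is now linear in [M] with coefficient
     [q = N * alpha / (4 * c^2)], and [alpha > 8 * c^2 / N] says exactly that [q > s]. *)
  have [|||||||||n0 [D hD]] := rate c theta (1 / 2) (c / 2)
    (N%:R * alpha / (4 * c ^+ 2)) 2 KL c0 _ _ _ c20.
  - by rewrite th0.
  - by lra.
  - by rewrite g1E ler_pdivrMr; lra.
  - by move=> <-; lra.
  - by rewrite ltr_pdivlMr ?mulr_gt0//; lra.
  - by rewrite g1E; lra.
  - by rewrite g1E; lra.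
  - by rewrite g1E; lra.
  - exists 0 => M' M'0; rewrite (_ : 2 * (1 / 2) = 1 :> R); last by lra.
    rewrite powRr1// le_eqVlt; apply/orP; left; apply/eqP.
    by field; rewrite gt_eqF.
  apply: bigO_of_le enorm_x hD _ => t t0; rewrite -powR_inv1//.
  by congr (_ `^ _); lra.
Qed.
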